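(* Let $G$ be a finite simple graph with $\alpha(G) \leq 2$ that contains no induced subgraph isomorphic to $\overline{K_{1,6}}$ (the complement of the star $K_{1,6}$, i.e. the disjoint union of a $K_6$ and an isolated vertex). Then $h(G) \geq \chi(G)$.
   Context: All graphs are finite, undirected and simple. $\alpha(G)$ is the independence number and $\chi(G)$ the chromatic number of $G$. $h(G)$ denotes the largest $t$ such that $G$ contains $K_t$ as a minor (a minor is obtained by a sequence of vertex deletions, edge deletions and edge contractions). *)

(* Defs.v *)
(* Plain MathComp, with classical logic (mathcomp.classical.boolp) used only to
   turn "K_t is a minor of G" into a boolean. *)
From HB Require Import structures.
From mathcomp Require Import all_boot.
From mathcomp Require Import boolp.

Set Implicit Arguments.
Unset Strict Implicit.
Unset Printing Implicit Defensive.

Record sgraph := SGraph {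
  vertex :> finType;
  adj : rel vertex;
  adj_sym : symmetric adj;
  adj_irr : irreflexive adj }.

Arguments adj {s}.
Arguments SGraph : clear implicits.

Definition sgraph_iso (G H : sgraph) : Prop :=
  exists2 f : G -> H, bijective f & forall x y, adj (f x) (f y) = adj x y.

Section Constructions.
Variable G : sgraph.

Definition compl_adj : rel G := fun x y => (x != y) && ~~ adj x y.

Fact compl_sym : symmetric compl_adj.
Proof. by move=> x y; rewrite /compl_adj eq_sym adj_sym. Qed.

Fact compl_irr : irreflexive compl_adj.
Proof. by move=> x; rewrite /compl_adj eqxx. Qed.

Definition compl_graph := SGraph G compl_adj compl_sym compl_irr.

Definition induced_adj (S : {set G}) : rel {x : G | x \in S} :=
  fun x y => adj (val x) (val y).

Fact induced_sym S : symmetric (@induced_adj S).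
Proof. by move=> x y; rewrite /induced_adj adj_sym. Qed.

Fact induced_irr S : irreflexive (@induced_adj S).
Proof. by move=> x; rewrite /induced_adj adj_irr. Qed.

Definition induced (S : {set G}) :=
  SGraph {x : G | x \in S} (@induced_adj S) (@induced_sym S) (@induced_irr S).

Definition del_vertex (v : G) := induced [set~ v].

Definition del_edge_adj (u v : G) : rel G :=
  fun x y => adj x y && ([set x; y] != [set u; v]).

Fact del_edge_sym u v : symmetric (del_edge_adj u v).
Proof. by move=> x y; rewrite /del_edge_adj adj_sym setUC. Qed.

Fact del_edge_irr u v : irreflexive (del_edge_adj u v).
Proof. by move=> x; rewrite /del_edge_adj adj_irr. Qed.

Definition del_edge (u v : G) :=
  SGraph G (del_edge_adj u v) (del_edge_sym u v) (del_edge_irr u v).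

(* The vertex v is removed and u stands for the merged vertex: u inherits the
   neighbours of v; parallel edges collapse and the loop at u is dropped. *)
Definition contract_adj (u v : G) : rel {x : G | x != v} :=
  fun x y => (x != y) &&
    [|| adj (val x) (val y), (val x == u) && adj v (val y)
      | (val y == u) && adj v (val x)].

Fact contract_sym u v : symmetric (@contract_adj u v).
Proof.
move=> x y; rewrite /contract_adj eq_sym adj_sym; congr (_ && (_ || _)).
exact: orbC.
Qed.

Fact contract_irr u v : irreflexive (@contract_adj u v).
Proof. by move=> x; rewrite /contract_adj eqxx. Qed.

Definition contract_edge (u v : G) :=
  SGraph {x : G | x != v} (@contract_adj u v)
    (@contract_sym u v) (@contract_irr u v).

End Constructions.

Section StandardGraphs.

Definition complete_adj (n : nat) : rel 'I_n := fun x y => x != y.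

Fact complete_sym n : symmetric (@complete_adj n).
Proof. by move=> x y; rewrite /complete_adj eq_sym. Qed.

Fact complete_irr n : irreflexive (@complete_adj n).
Proof. by move=> x; rewrite /complete_adj eqxx. Qed.

Definition complete_graph (n : nat) :=
  SGraph 'I_n (@complete_adj n) (@complete_sym n) (@complete_irr n).

Definition is_inl (A B : Type) (x : A + B) : bool := if x is inl _ then true else false.

Definition bipartite_adj (m n : nat) : rel ('I_m + 'I_n)%type :=
  fun x y => is_inl x != is_inl y.

Fact bipartite_sym m n : symmetric (@bipartite_adj m n).
Proof. by move=> x y; rewrite /bipartite_adj eq_sym. Qed.

Fact bipartite_irr m n : irreflexive (@bipartite_adj m n).
Proof. by move=> x; rewrite /bipartite_adj eqxx. Qed.

Definition complete_bipartite (m n : nat) :=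
  SGraph ('I_m + 'I_n)%type (@bipartite_adj m n)
    (@bipartite_sym m n) (@bipartite_irr m n).

End StandardGraphs.

Definition contains_induced (G H : sgraph) : Prop :=
  exists S : {set G}, sgraph_iso (induced S) H.

Definition stable (G : sgraph) (S : {set G}) : bool :=
  [forall x in S, forall y in S, ~~ adj x y].

Definition independence_number (G : sgraph) : nat :=
  \max_(S : {set G} | stable S) #|S|.

Definition colorable (G : sgraph) (k : nat) : bool :=
  [exists c : {ffun G -> 'I_k}, forall x, forall y, adj x y ==> (c x != c y)].

Fact colorable_ex (G : sgraph) : exists k, colorable G k.
Proof.
exists #|G|; apply/existsP; exists [ffun x => enum_rank x].
apply/forallP=> x; apply/forallP=> y; apply/implyP=> xy; rewrite !ffunE.
by apply: contraTneq xy => /enum_rank_inj ->; rewrite adj_irr.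
Qed.

Definition chromatic_number (G : sgraph) : nat := ex_minn (colorable_ex G).

Inductive minor_step (G : sgraph) : sgraph -> Prop :=
| StepDelVertex (v : G) : minor_step G (del_vertex v)
| StepDelEdge (u v : G) of adj u v : minor_step G (del_edge u v)
| StepContract (u v : G) of adj u v : minor_step G (contract_edge u v).

Inductive minor_seq (G : sgraph) : sgraph -> Prop :=
| MinorRefl : minor_seq G G
| MinorStep (H K : sgraph) of minor_seq G H & minor_step H K : minor_seq G K.

Definition has_minor (G H : sgraph) : Prop :=
  exists2 M : sgraph, minor_seq G M & sgraph_iso M H.

Lemma minor_step_card (G H : sgraph) : minor_step G H -> #|H| <= #|G|.
Proof. by case=> [v|u v _|u v _] //=; rewrite card_sig max_card. Qed.

Lemma minor_seq_card (G H : sgraph) : minor_seq G H -> #|H| <= #|G|.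
Proof. by elim=> // M K _ IH /minor_step_card/leq_trans; apply. Qed.

Lemma has_complete_minor_card (G : sgraph) (t : nat) :
  has_minor G (complete_graph t) -> t <= #|G|.
Proof.
case=> M /minor_seq_card leMG [f bij_f _].
by apply: leq_trans leMG; rewrite (bij_eq_card bij_f) card_ord.
Qed.

Lemma has_complete0_minor (G : sgraph) : has_minor G (complete_graph 0).
Proof.
have [n] : exists n, exists2 M, minor_seq G M & #|M| <= n.
  by exists #|G|, G; first exact: MinorRefl.
elim: n => [|n IHn] [M GM leMn].
  move: leMn; rewrite leqn0 => /eqP M0.
  have noM (x : M) : False by have := max_card (pred1 x); rewrite card1 M0.
  have no0 (i : 'I_0) : False by case: i.
  exists M => //; exists (fun x => False_rect _ (noM x)); last by move=> x.
  by exists (fun i => False_rect _ (no0 i)) => [x|i]; [case: (noM x)|case: (no0 i)].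
have [v _|M0] := pickP (@predT M); last by apply: IHn; exists M; rewrite // eq_card0.
apply: IHn; exists (del_vertex v); first exact: MinorStep GM (StepDelVertex v).
rewrite /= card_sig -ltnS; apply: leq_trans leMn; rewrite [X in _ <= X](cardD1 v) add1n ltnS.
by apply/subset_leq_card/subsetP=> x; rewrite !inE andbT.
Qed.

Definition has_complete_minor (G : sgraph) (t : nat) : bool :=
  `[< has_minor G (complete_graph t) >].

Fact has_complete_minor_ex (G : sgraph) : exists t, has_complete_minor G t.
Proof. by exists 0; apply/asboolP; exact: has_complete0_minor. Qed.

Fact has_complete_minor_bound (G : sgraph) (t : nat) :
  has_complete_minor G t -> t <= #|G|.
Proof. by move/asboolP; exact: has_complete_minor_card. Qed.

Definition hadwiger_number (G : sgraph) : nat :=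
  ex_maxn (has_complete_minor_ex G) (@has_complete_minor_bound G).

(* Main.v *)
(* Let e be the non-adjacency relation of G; it is triangle-free because
   alpha(G) <= 2, and every vertex has at most 5 e-neighbours because G has no
   induced disjoint union of K_6 and K_1.  The chromatic number of G is at most
   the number of vertices minus the size of any e-matching, so it suffices to
   find, for each set S of vertices, an e-matching m and a clique minor inside S
   with at least |S| - |m| branch sets.

   In a minimal counterexample S, e is connected on S, and Gallai's lemma says
   that some maximum matching misses exactly one vertex; so |S| = 2k - 1 and S
   has no K_k minor.  A branch set consisting of two vertices that dominates S
   can be deleted, so any two vertices that are not e-adjacent have a common
   e-neighbour, and a variant with two branch sets of size two shows that
   vertices with private second neighbours are rare.  Counting paths of length
   two from a vertex then gives |S| <= 17 and a lower bound on the size s of a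
   largest e-independent set K (a clique of G), enough to have k - s <= 3.

   It remains to find k - s disjoint seagulls outside K, a seagull being an
   e-edge together with a vertex e-adjacent to neither end: a seagull is
   connected in G and adjacent to every vertex outside it.  A seagull-free set
   is e-independent or complete bipartite for e, so if a packing is too small, S
   minus the packing is a union of two e-independent sets, the larger of which
   has size s; local exchanges between the other one and a seagull enlarge the
   packing or produce an e-independent set of size s + 1. *)
Require Import Defs.
From mathcomp Require Import all_boot.
From mathcomp Require Import boolp.
From mathcomp Require Import zify.

Set Implicit Arguments.
Unset Strict Implicit.
Unset Printing Implicit Defensive.

(** * Clique minors from branch sets *)

Definition branching (G : sgraph) (t : nat) (f : G -> option 'I_t) : Prop :=
  [/\ forall i, exists x, f x = Some i,
      forall i (X : {set G}), (exists x, x \in X) ->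
        (forall x, x \in X -> f x = Some i) ->
        (exists2 y, f y = Some i & y \notin X) ->
        exists x y, [/\ x \in X, y \notin X, f y = Some i & adj x y]
    & forall i j, i != j -> exists x y, [/\ f x = Some i, f y = Some j & adj x y]].

Lemma minor_seq_step (G H K : sgraph) :
  minor_step G H -> minor_seq H K -> minor_seq G K.
Proof.
move=> GH; elim=> [|M N _ GM MN]; last exact: MinorStep GM MN.
exact: MinorStep (MinorRefl G) GH.
Qed.

(** Induction on the order: delete a vertex in no branch set, else contract an edge inside a branch
    set with two vertices, else the graph is already complete. *)
Lemma branching_minor (t : nat) (G : sgraph) (f : G -> option 'I_t) :
  branching f -> has_minor G (complete_graph t).
Proof.
have [n] := ubnP #|G|; elim: n => // n IHn in G f *; rewrite ltnS => leGn [onto conn touch].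
have [v fv|allS] := pickP [pred v | f v == None].
  have ltn : #|del_vertex v| < n.
    apply: leq_trans leGn; rewrite /= card_sig [X in _ < X](cardD1 v) add1n ltnS.
    by apply/subset_leq_card/subsetP=> x; rewrite !inE andbT.
  have nv x i : f x = Some i -> x \in [set~ v].
    by move=> fx; rewrite !inE; apply/eqP=> xv; move: fv; rewrite /= -xv fx.
  have [] := IHn (del_vertex v) (fun x => f (val x)) ltn.
    split=> [i|i X [x Xx] fX [y fy Xy]|i j ij].
    - by have [x fx] := onto i; exists (Sub x (nv _ _ fx)).
    - have h1 : exists x0, x0 \in val @: X by exists (val x); apply: imset_f.
      have h2 x0 : x0 \in val @: X -> f x0 = Some i by case/imsetP=> w wX ->; apply: fX.
      have h3 : exists2 y0, f y0 = Some i & y0 \notin val @: X.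
        by exists (val y) => //; rewrite mem_imset //; exact: val_inj.
      have [x1 [y1 [X1 Y1 fy1 a1]]] := conn i _ h1 h2 h3.
      case/imsetP: X1 a1 => w wX -> a1; exists w, (Sub y1 (nv _ _ fy1)); split=> //.
      by apply: contra Y1 => h; apply/imsetP; exists (Sub y1 (nv _ _ fy1)).
    - have [x [y [fx fy a]]] := touch i j ij.
      by exists (Sub x (nv _ _ fx)), (Sub y (nv _ _ fy)).
  by move=> M GM iso; exists M => //; apply: minor_seq_step GM; exact: StepDelVertex.
have fS x : exists i, f x = Some i.
  by move: (allS x) => /=; case: (f x) => [i|//]; exists i.
have [[v w] /= /andP[vw /eqP fvw]|inj] := pickP [pred p : G * G | (p.1 != p.2) && (f p.1 == f p.2)].
  have [i fv] := fS v.
  have h1 : exists x, x \in [set v] by exists v; rewrite inE.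
  have h2 x : x \in [set v] -> f x = Some i by move/set1P->.
  have h3 : exists2 y, f y = Some i & y \notin [set v].
    by exists w; rewrite -?fvw // inE eq_sym.
  (* The cut separating [v] from the rest of its fibre provides the edge to contract. *)
  have [z [u [zv uv fu auv]]] := conn i _ h1 h2 h3.
  move/set1P: zv auv => -> auv; rewrite inE in uv.
  have ltn : #|contract_edge u v| < n.
    apply: leq_trans leGn; rewrite /= card_sig [X in _ < X](cardD1 v) add1n ltnS.
    by apply/subset_leq_card/subsetP=> y; rewrite !inE andbT.
  (* The quotient map of the contraction, sending [v] to [u]. *)
  pose c (y : G) : contract_edge u v := if insub y is Some z then z else Sub u uv.
  have cE y : val (c y) = if y == v then u else y.
    by rewrite /c; case: insubP => [z1 yv ->|/negbNE ->] //; rewrite (negPf yv).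
  have fc y : f (val (c y)) = f y.
    by rewrite cE; case: eqP => // ->; rewrite fu fv.
  have cadj x y : val (c x) != val (c y) -> adj x y -> adj (c x) (c y).
    move=> cxy axy; have nxy : c x != c y by apply: contra cxy => /eqP ->.
    rewrite /adj /= /contract_adj nxy /=; move: cxy; rewrite !cE.
    case: (eqVneq x v) axy => [->|xv]; case: (eqVneq y v) => [->|yv] axy; rewrite ?eqxx //=.
    - by rewrite axy orbT.
    - by rewrite [adj v x]adj_sym axy !orbT.
    - by rewrite axy.
  have [] := IHn (contract_edge u v) (fun y => f (val y)) ltn.
    split=> [j|j X [x Xx] fX [y fy Xy]|j k jk].
    - by have [y fy] := onto j; exists (c y); rewrite fc.
    - have cK x0 : c (val x0) = x0 by apply: val_inj; rewrite cE (negPf (valP x0)).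
      have k1 : exists x0, x0 \in [set x0 | c x0 \in X] by exists (val x); rewrite inE cK.
      have k2 x0 : x0 \in [set x0 | c x0 \in X] -> f x0 = Some j.
        by rewrite inE => /fX; rewrite fc.
      have k3 : exists2 y0, f y0 = Some j & y0 \notin [set x0 | c x0 \in X].
        by exists (val y); rewrite // inE cK.
      have [x1 [y1 [X1 Y1 fy1 a1]]] := conn j _ k1 k2 k3.
      rewrite !inE in X1 Y1; exists (c x1), (c y1); split=> //; first by rewrite fc.
      by apply: cadj => //; apply: contraNneq Y1 => h; rewrite (_ : c y1 = c x1) //; exact: val_inj.
    - have [x [y [fx fy a]]] := touch j k jk.
      exists (c x), (c y); rewrite !fc; split=> //; apply: cadj => //.
      by move: jk; apply: contra => /eqP h; have := fc x; rewrite h fc fy fx => -[->].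
  by move=> M GM iso; exists M => //; apply: minor_seq_step GM; apply: StepContract; rewrite adj_sym.
have finj x y : f x = f y -> x = y.
  by move=> fxy; apply/eqP; move: (inj (x, y)); rewrite /= fxy eqxx andbT => /negbFE.
exists G; first exact: MinorRefl.
have [h hE] := choice fS; have hS i := onto i.
have [g gE] := choice hS.
exists h.
  exists g => [x|i]; first by apply: finj; rewrite gE hE.
  by apply: Some_inj; rewrite -hE gE.
move=> x y; rewrite /adj /= /complete_adj.
have [hxy|hxy] := eqVneq (h x) (h y).
  have ->: x = y by apply: finj; rewrite !hE hxy.
  by rewrite -[LHS]/false; exact: esym (adj_irr y).
have [x1 [y1 [fx fy a]]] := touch _ _ hxy.
rewrite (_ : x = x1); last by apply: finj; rewrite hE.
by rewrite (_ : y = y1) //; apply: finj; rewrite hE.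
Qed.

(** * Clique models as families of sets *)

Section Models.

Variables (T : finType) (r : rel T).
Implicit Types (B C S X : {set T}) (P Q : {set {set T}}).

Definition touch B C : bool := [exists x in B, exists y in C, r x y].

Lemma touchP B C :
  reflect (exists x y, [/\ x \in B, y \in C & r x y]) (touch B C).
Proof.
apply: (iffP exists_inP) => [[x xB /exists_inP[y yC xy]]|[x [y [xB yC xy]]]].
  by exists x, y.
by exists x => //; apply/exists_inP; exists y.
Qed.

Definition connected_set B : Prop :=
  B != set0 /\
  forall X, X \subset B -> X != set0 -> X != B -> touch X (B :\: X).

Definition model S P : Prop :=
  [/\ forall B, B \in P -> B \subset S,
      forall B, B \in P -> connected_set B
    & {in P &, forall B C, B != C -> [disjoint B & C] && touch B C}].

Lemma connected1 x : connected_set [set x].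
Proof.
split=> [|X]; first by apply/set0Pn; exists x; rewrite inE.
by rewrite subset1 => /orP[/eqP->|/eqP->]; rewrite eqxx.
Qed.

Lemma model_sub S1 S2 P : S1 \subset S2 -> model S1 P -> model S2 P.
Proof. by move=> s12 [sP cP dP]; split=> // B /sP/subset_trans; apply. Qed.

Lemma model0 S : model S set0.
Proof. by split=> [B|B|B C]; rewrite inE. Qed.

Lemma model1 B : connected_set B -> model B [set B].
Proof.
move=> cB; split=> [C /set1P->|C /set1P->|C D /set1P-> /set1P->] //.
by rewrite eqxx.
Qed.

Lemma model_clique (K : {set T}) :
  {in K &, forall x y, x != y -> r x y} ->
  model K [set [set x] | x in K] /\ #|[set [set x] | x in K]| = #|K|.
Proof.
move=> cK; split; last by rewrite card_imset //; exact: set1_inj.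
split=> [_ /imsetP[x xK ->]|_ /imsetP[x xK ->]|].
- by rewrite sub1set.
- exact: connected1.
move=> _ _ /imsetP[x xK ->] /imsetP[y yK ->] xy.
have nxy : x != y by apply: contra xy => /eqP->.
rewrite disjoints1 inE nxy; apply/touchP.
by exists x, y; rewrite !inE !eqxx cK.
Qed.

Hypothesis r_sym : symmetric r.

Lemma touch_sym B C : touch B C = touch C B.
Proof. by apply/touchP/touchP=> -[x [y [? ? ?]]]; exists y, x; rewrite r_sym. Qed.

Lemma modelU S1 S2 P1 P2 :
    [disjoint S1 & S2] -> model S1 P1 -> model S2 P2 ->
    (forall B C, B \in P1 -> C \in P2 -> touch B C) ->
  model (S1 :|: S2) (P1 :|: P2) /\ #|P1 :|: P2| = #|P1| + #|P2|.
Proof.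
move=> d12 [s1 c1 d1] [s2 c2 d2] t12.
have dBC B C : B \in P1 -> C \in P2 -> [disjoint B & C].
  by move=> /s1 B1 /s2 C2; apply: disjointWl B1 (disjointWr C2 d12).
split; last first.
  rewrite cardsU (_ : P1 :&: P2 = set0) ?cards0 ?subn0 //.
  apply/setP=> B; rewrite !inE; apply/negP=> /andP[B1 B2].
  have := dBC _ _ B1 B2; rewrite -setI_eq0 setIid => /eqP B0.
  by have [] := c1 _ B1; rewrite B0 eqxx.
split=> [B|B|B C]; rewrite !inE.
- by case/orP=> [/s1|/s2] sB; apply: (subset_trans sB); rewrite ?subsetUl ?subsetUr.
- by case/orP=> [/c1|/c2].
move=> /orP[BP|BP] /orP[CP|CP] BC; [exact: d1| | |exact: d2].
  by rewrite t12 // dBC.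
by rewrite disjoint_sym touch_sym t12 // dBC.
Qed.

Lemma model_add S B P :
    connected_set B -> B \subset S -> (forall C, C \in P -> touch B C) ->
    model (S :\: B) P ->
  model S (B |: P) /\ #|B |: P| = #|P|.+1.
Proof.
move=> cB BS tB mP.
have [||mU cU] := modelU _ (model1 cB) mP.
- by rewrite -setI_eq0 setIDA setIC -setIDA setDv setI0.
- by move=> _ C /set1P->; exact: tB.
rewrite cU cards1; split=> //.
by rewrite setUC setDE setUIl (setUidPl BS) [_ :|: B]setUC setUCr setIT in mU.
Qed.

(** Branch sets are nonempty and lie in [S :\: B], so each contains a vertex dominated by [B]. *)
Lemma dominating_touch S B P :
    (forall x, x \in S :\: B -> exists2 b, b \in B & r b x) -> model (S :\: B) P ->
  forall C, C \in P -> touch B C.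
Proof.
move=> dom [sP cP _] C CP; have [/set0Pn[x xC] _] := cP _ CP.
have [b bB bx] := dom x (subsetP (sP _ CP) _ xC).
by apply/touchP; exists b, x.
Qed.

Lemma model_dominating S B P :
    connected_set B -> B \subset S ->
    (forall x, x \in S :\: B -> exists2 b, b \in B & r b x) ->
    model (S :\: B) P ->
  model S (B |: P) /\ #|B |: P| = #|P|.+1.
Proof. by move=> cB BS dom mP; apply: model_add => //; exact: dominating_touch dom mP. Qed.

Lemma connected2 x y : r x y -> connected_set [set x; y].
Proof.
move=> xy; split=> [|X Xs /set0Pn[z zX] Xn].
  by apply/set0Pn; exists x; rewrite !inE eqxx.
have [w wS wX] : exists2 w, w \in [set x; y] & w \notin X.
  by apply/subsetPn; apply: contra Xn => h; rewrite eqEsubset Xs.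
apply/touchP; exists z, w; rewrite zX in_setD wX wS; split=> //.
have zS := subsetP Xs _ zX; have nzw : z != w by apply: contraNneq wX => <-.
move: zS wS nzw; rewrite !inE.
by case/orP=> /eqP-> /orP[]/eqP->; rewrite ?eqxx // r_sym.
Qed.

End Models.

(** Disjointness makes the block of a vertex unique, so [pick] recovers it and the blocks become the
    fibres of a branching. *)
Lemma model_hadwiger (G : sgraph) (P : {set {set G}}) :
  model (@adj G) [set: G] P -> #|P| <= hadwiger_number G.
Proof.
case=> _ cP dP; rewrite /hadwiger_number; case: ex_maxnP => t _; apply.
apply/asboolP.
pose blk (i : 'I_#|P|) := enum_val i.
have blkP i : blk i \in P by exact: enum_valP.
pose f (x : G) := [pick i | x \in blk i].
have fE x i : x \in blk i -> f x = Some i.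
  rewrite /f; case: pickP => [j xj xi|/(_ i)->] //.
  congr Some; apply/eqP; apply/negPn/negP=> ji.
  have bij : blk j != blk i by apply: contra ji => /eqP/enum_val_inj->.
  have /andP[dij _] := dP _ _ (blkP j) (blkP i) bij.
  by have := disjointFr dij xj; rewrite xi.
have fI x i : f x = Some i -> x \in blk i.
  by rewrite /f; case: pickP => [j xj [<-]|].
apply: (@branching_minor _ _ f); split=> [i|i X [x xX] Xi [y fy yX]|i j ij].
- by have [/set0Pn[x xi] _] := cP _ (blkP i); exists x; exact: fE.
- have [_ h] := cP _ (blkP i).
  have Xsub : X \subset blk i by apply/subsetP=> z /Xi/fI.
  have X0 : X != set0 by apply/set0Pn; exists x.
  have Xn : X != blk i by apply: contra yX => /eqP->; exact: fI.
  have /touchP[a [b [aX]]] := h X Xsub X0 Xn.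
  by rewrite inE => /andP[bX bi] ab; exists a, b; split=> //; exact: fE.
- have bij : blk i != blk j by apply: contra ij => /eqP/enum_val_inj->.
  have /andP[_ /touchP[x [y [xi yj xy]]]] := dP _ _ (blkP i) (blkP j) bij.
  by exists x, y; split=> //; exact: fE.
Qed.

(** * Matchings and Gallai's lemma *)

Section Involution.

Variables (T : finType) (A : {set T}) (m : T -> T).
Hypotheses (mK : {in A, forall x, m (m x) = x}) (mA : {in A, forall x, m x \in A}).

Definition invol_reps := [set x in A | enum_rank x <= enum_rank (m x)].

(** The representatives and their image under [m] cover [A] and meet exactly in the fixed points. *)
Lemma card_involution :
  #|A| + #|[set x in A | m x == x]| = 2 * #|invol_reps|.
Proof.
pose R' := [set x in A | enum_rank (m x) <= enum_rank x].
have cR : #|R'| = #|invol_reps|.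
  have -> : R' = m @: invol_reps.
    apply/setP=> x; rewrite inE; apply/andP/imsetP=> [[xA le]|[y]].
      by exists (m x); rewrite ?mK // inE mA // mK.
    by rewrite inE => /andP[yA le] ->; rewrite mA // mK.
  apply: card_in_imset => x y; rewrite !inE => /andP[xA _] /andP[yA _] mxy.
  by rewrite -(mK xA) mxy mK.
have -> : #|A| = #|invol_reps :|: R'|.
  apply: eq_card => x; rewrite !inE; case: (x \in A) => //=.
  by rewrite leq_total.
have -> : [set x in A | m x == x] = invol_reps :&: R'.
  apply/setP=> x; rewrite !inE; case: (x \in A) => //=.
  by rewrite -eqn_leq eq_sym -(inj_eq enum_rank_inj) -(inj_eq val_inj).
by rewrite cardsUI cR; lia.
Qed.

End Involution.

Section Matching.

Variables (T : finType) (e : rel T).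
Hypotheses (e_sym : symmetric e) (e_irr : irreflexive e).
Implicit Types (S X C : {set T}) (P : {set {set T}}) (m M N : {ffun T -> T}).

(** In the application [e] is the non-adjacency of the graph: matchings live in [e], clique models
    in [nonadj]. *)
Definition nonadj : rel T := fun x y => (x != y) && ~~ e x y.

Lemma nonadj_sym : symmetric nonadj.
Proof. by move=> x y; rewrite /nonadj eq_sym e_sym. Qed.

(** A matching is an involution of the whole type, whose fixed points are the missed vertices and
    everything outside [S]. *)
Definition matching S m : bool :=
  [forall x, [&& m (m x) == x, (x \notin S) ==> (m x == x)
               & (m x == x) || e x (m x)]].

Lemma matchingP S m :
  reflect [/\ forall x, m (m x) = x, forall x, x \notin S -> m x = x
            & forall x, m x = x \/ e x (m x)] (matching S m).
Proof.
apply: (iffP forallP) => [h|[h1 h2 h3] x].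
  split=> x; have /and3P[/eqP h1 /implyP h2 h3] := h x => //.
    by move/h2/eqP.
  by case/orP: h3 => [/eqP|]; [left|right].
rewrite h1 eqxx /=; apply/andP; split; first by apply/implyP=> /h2->.
by have [->|->] := h3 x; rewrite ?eqxx ?orbT.
Qed.

Definition unmatched S m := [set x in S | m x == x].

Lemma matching_stable S m : matching S m -> {in S, forall x, m x \in S}.
Proof.
move=> /matchingP[mK mS _] x xS; apply/negPn/negP=> mxS.
by case/negP: (mxS); rewrite -(mS _ mxS) mK.
Qed.

Lemma matching_parity S m :
  matching S m -> #|S| + #|unmatched S m| = 2 * #|invol_reps S m|.
Proof.
move=> mS; have [mK _ _] := matchingP _ _ mS.
by apply: card_involution => [x _|]; [exact: mK|exact: matching_stable].
Qed.

(* |S| + #|unmatched S m| is twice the number of classes of the colouring of S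
   whose classes are the edges of m and the unmatched vertices. *)
Definition matched_model S : Prop :=
  exists m P, [/\ matching S m, model nonadj S P
                & #|S| + #|unmatched S m| <= 2 * #|P|].

Lemma matching_sub S1 S2 m : S1 \subset S2 -> matching S1 m -> matching S2 m.
Proof.
move=> s12 /matchingP[h1 h2 h3]; apply/matchingP; split=> // x xS.
by apply: h2; apply: contra xS; exact: (subsetP s12).
Qed.

(** * Minimal sets without a matched model *)

Section Critical.

Variable S : {set T}.
Hypothesis noS : ~ matched_model S.
Hypothesis IH : forall S', S' \proper S -> matched_model S'.

Definition maximum m : bool :=
  matching S m && [forall N, matching S N ==> (#|unmatched S m| <= #|unmatched S N|)].

Lemma maximumP m : reflect (matching S m /\
   forall N, matching S N -> #|unmatched S m| <= #|unmatched S N|) (maximum m).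
Proof.
apply: (iffP andP) => [[mS /forallP h]|[mS h]]; split=> //.
  by move=> N; apply/implyP.
by apply/forallP=> N; apply/implyP; exact: h.
Qed.

(** The matching of a matched model of [S :\ v] misses [v]. A better matching of [S] would miss at
    least two fewer vertices by parity, and with the same model it would be a matched model of
    [S]. *)
Lemma maximum_missing v : v \in S -> exists2 m, maximum m & m v = v.
Proof.
move=> vS; have [] := IH (properD1 vS).
move=> m [P [mS mP le]]; exists m; last first.
  by have [_ h _] := matchingP _ _ mS; apply: h; rewrite !inE eqxx.
have mS' : matching S m by apply: matching_sub mS; exact: subsetDl.
have um : #|unmatched S m| = #|unmatched (S :\ v) m|.+1.
  rewrite (cardsD1 v) inE vS /=.
  have [_ h _] := matchingP _ _ mS.
  rewrite h ?eqxx ?inE ?eqxx // add1n; congr _.+1; apply: eq_card => x.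
  by rewrite !inE; case: (x == v).
have cS := cardsD1 v S; rewrite vS in cS.
apply/maximumP; split=> // N NS; rewrite leqNgt; apply/negP=> lt.
apply: noS; exists N, P; split=> //; first by apply: model_sub mP; exact: subsetDl.
by have := matching_parity mS'; have := matching_parity NS; move: le cS um lt; clear; lia.
Qed.

(** The relation of Gallai's argument: it contains the [e]-edges inside [S] and is transitive there,
    so no [e]-edge leaves a class. *)
Definition never_both u v : bool :=
  (u == v) || [forall m, maximum m ==> ~~ ((m u == u) && (m v == v))].

Lemma never_bothP u v : reflect
  (u = v \/ forall m, maximum m -> m u = u -> m v = v -> False) (never_both u v).
Proof.
apply: (iffP orP) => [[/eqP|/forallP h]|[->|h]]; [by left|right|by left|right].
  by move=> m /(implyP (h m)) /negP k mu mv; apply: k; rewrite mu mv !eqxx.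
by apply/forallP=> m; apply/implyP=> mm; apply/negP=> /andP[/eqP mu /eqP]; exact: (h m).
Qed.

(** Otherwise adding the edge to the matching would cover two more vertices. *)
Lemma never_both_edge u v : u \in S -> v \in S -> e u v -> never_both u v.
Proof.
move=> uS vS uv; apply/never_bothP; right=> m /maximumP[mS mm] mu mv.
have [mK mO me] := matchingP _ _ mS.
have nuv : u != v by apply: contraTneq uv => ->; rewrite e_irr.
pose m' := [ffun x => if x == u then v else if x == v then u else m x].
have m'S : matching S m'.
  apply/matchingP; split=> x; rewrite !ffunE.
  - have [->|xu] := eqVneq x u; first by rewrite eqxx eq_sym (negPf nuv).
    have [->|xv] := eqVneq x v; first by rewrite eqxx.
    have [h|] := eqVneq (m x) u; first by move: xu; rewrite -(mK x) h mu eqxx.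
    by have [h|] := eqVneq (m x) v; first by move: xv; rewrite -(mK x) h mv eqxx.
  - have [->|xu] := eqVneq x u; first by rewrite uS.
    have [->|xv] := eqVneq x v; first by rewrite vS.
    exact: mO.
  - have [->|xu] := eqVneq x u; first by right.
    have [->|xv] := eqVneq x v; first by right; rewrite e_sym.
    exact: me.
have := mm _ m'S; rewrite leqNgt => /negP[]; apply: proper_card.
apply/properP; split.
  apply/subsetP=> x; rewrite !inE ffunE => /andP[-> /=].
  have [->|xu] := eqVneq x u; first by rewrite mu.
  by have [->|xv] := eqVneq x v; first by rewrite mv.
by exists u; rewrite !inE ?ffunE uS /= ?mu ?eqxx // eq_sym.
Qed.

Definition agreement M N := #|[set x | M x == N x]|.

(* Take M missing u and w, and N missing v with N agreeing as much as possible
   with M; rotating one edge of N would increase the agreement. *)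
Lemma never_both_trans u v w : u \in S -> v \in S -> w \in S ->
  never_both u v -> never_both v w -> never_both u w.
Proof.
move=> uS vS wS /never_bothP[->//|uv] /never_bothP[<-|vw]; first by apply/never_bothP; right.
have [->|nuw] := eqVneq u w; first by apply/never_bothP; left.
apply/never_bothP; right=> M maxM Mu Mw.
have [N0 maxN0 N0v] := maximum_missing vS.
have hN0 : maximum N0 && (N0 v == v) by rewrite maxN0 N0v eqxx.
have [N /andP[maxN /eqP Nv] bestN] :=
  @arg_maxnP _ N0 (fun N => maximum N && (N v == v)) (fun N => agreement M N) hN0.
have [MS mM] := maximumP _ maxM; have [NS mN] := maximumP _ maxN.
have [MK MO Me] := matchingP _ _ MS; have [NK NO Ne] := matchingP _ _ NS.
have Nu : N u != u by apply/negP=> /eqP Nu; exact: (uv _ maxN Nu Nv).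
have Nw : N w != w by apply/negP=> /eqP Nw; exact: (vw _ maxN Nv Nw).
have ceq : #|unmatched S M| = #|unmatched S N| by apply/eqP; rewrite eqn_leq mM // mN.
(* Both matchings miss equally many vertices and [N] covers [u] and [w], so [N] misses at least two
   vertices covered by [M], one of them other than [v]. *)
have [x xv [xS Mx Nx]] : exists2 x, x != v & [/\ x \in S, M x != x & N x = x].
  have two : 2 <= #|unmatched S N :\: unmatched S M|.
    have e1 := cardsID (unmatched S M) (unmatched S N).
    have e2 := cardsID (unmatched S N) (unmatched S M).
    have : 2 <= #|unmatched S M :\: unmatched S N|.
      have <- : #|[set u; w]| = 2 by rewrite cards2 nuw.
      apply/subset_leq_card/subsetP=> y; rewrite !inE.
      by case/orP=> /eqP->; rewrite ?uS ?wS /= ?Nu ?Nw ?Mu ?Mw eqxx.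
    by move: ceq e1 e2; rewrite (setIC (unmatched S N)); clear; lia.
  have : 0 < #|(unmatched S N :\: unmatched S M) :\ v|.
    by move: two; rewrite (cardsD1 v); case: (v \in _); clear; lia.
  case/card_gt0P=> x; rewrite !inE => /and3P[xv h /andP[xS /eqP Nx]].
  by exists x => //; split=> //; move: h; rewrite xS.
pose y := M x; pose z := N y.
have exy : e x y by case: (Me x) => // h; rewrite h eqxx in Mx.
have yS : y \in S by apply: matching_stable xS.
have Ny : N y != y.
  apply/negP=> /eqP Ny; have /never_bothP[xy|h] := never_both_edge xS yS exy.
    by rewrite xy e_irr in exy.
  exact: h maxN Nx Ny.
have xy : x != y by apply: contraTneq exy => ->; rewrite e_irr.
have zx : z != x by apply: contra xy => /eqP zx; rewrite -(NK y) -/z zx Nx.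
have zy : z != y by [].
have Nz : N z = y by rewrite NK.
have vy : v != y by apply: contraNneq Ny => <-; rewrite Nv.
have vz : v != z by apply: contra vy => /eqP vz; rewrite -Nz -vz Nv.
(* The edge [y], [z] of [N] is traded for [x], [y]. This misses no more vertices, still misses [v],
   and agrees with [M] at [x]. *)
pose N' := [ffun a => if a == x then y else if a == y then x else if a == z then z else N a].
have N'S : matching S N'.
  apply/matchingP; split=> a; rewrite !ffunE.
  - have [->|ax] := eqVneq a x; first by rewrite eqxx eq_sym (negPf xy).
    have [->|ay] := eqVneq a y; first by rewrite eqxx.
    have [->|az] := eqVneq a z; first by rewrite (negPf zx) (negPf zy) eqxx.
    have [h|_] := eqVneq (N a) x; first by move: ax; rewrite -(NK a) h Nx eqxx.
    have [h|_] := eqVneq (N a) y; first by move: az; rewrite -(NK a) h eqxx.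
    have [h|_] := eqVneq (N a) z; first by move: ay; rewrite -(NK a) h Nz eqxx.
    exact: NK.
  - have [->|ax] := eqVneq a x; first by rewrite xS.
    have [->|ay] := eqVneq a y; first by rewrite yS.
    by have [->|az] := eqVneq a z; last exact: NO.
  - have [->|ax] := eqVneq a x; first by right.
    have [->|ay] := eqVneq a y; first by right; rewrite e_sym.
    by have [->|az] := eqVneq a z; [left|exact: Ne].
have zS : z \in S by apply: matching_stable yS.
have uN' : unmatched S N' = z |: (unmatched S N :\ x).
  apply/setP=> a; rewrite !inE ffunE.
  have [->|ax] := eqVneq a x; first by rewrite xS /= eq_sym (negPf xy) eq_sym (negPf zx).
  have [->|ay] := eqVneq a y.
    by rewrite yS /= (negPf xy) (eq_sym y z) (negPf zy).
  by have [->|az] := eqVneq a z; first by rewrite zS eqxx.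
have cN' : #|unmatched S N'| <= #|unmatched S N|.
  have xU : x \in unmatched S N by rewrite inE xS Nx eqxx.
  rewrite uN' cardsU1 [X in _ <= X](cardsD1 x) xU.
  by case: (z \notin _); clear; lia.
have maxN' : maximum N'.
  by apply/maximumP; split=> // N1 /mN; apply: leq_trans.
have N'v : N' v = v by rewrite ffunE eq_sym (negPf xv) (negPf vy) (negPf vz).
have : agreement M N' <= agreement M N by apply: bestN; rewrite maxN' N'v eqxx.
rewrite leqNgt => /negP[].
apply: proper_card; apply/properP; split.
  apply/subsetP=> a; rewrite !inE ffunE => /eqP Ma.
  have [h|ax] := eqVneq a x; first by rewrite h in Ma *.
  have [h|ay] := eqVneq a y; first by rewrite h /y MK.
  (* No agreement is lost at [z]: [M z = N z = y] would force [z = x]. *)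
  have [h|az] := eqVneq a z; last by rewrite Ma.
  by case/negP: zx; rewrite -(MK z) -h Ma h Nz /y MK.
by exists x; rewrite !inE ?ffunE ?eqxx // Nx.
Qed.

(** Without [e]-edges across, all branch sets of one side touch all those of the other, so matchings
    and models are simply united. *)
Lemma matched_model_join C : C \subset S ->
    (forall x y, x \in C -> y \in S :\: C -> ~~ e x y) ->
  matched_model C -> matched_model (S :\: C) -> matched_model S.
Proof.
move=> CS sep [m1 [P1 [m1C mP1 le1]]] [m2 [P2 [m2D mP2 le2]]].
have dis : [disjoint C & S :\: C] by rewrite -setI_eq0 setIDA setIC -setIDA setDv setI0.
have SE : C :|: (S :\: C) = S by rewrite setUC setDE setUIl (setUidPl CS) setUC setUCr setIT.
have [|mP cP] := modelU nonadj_sym dis mP1 mP2.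
  move=> B1 B2 B1P B2P; have [s1 c1 _] := mP1; have [s2 c2 _] := mP2.
  have [/set0Pn[x xB] _] := c1 _ B1P; have [/set0Pn[y yB] _] := c2 _ B2P.
  have xC := subsetP (s1 _ B1P) _ xB; have yD := subsetP (s2 _ B2P) _ yB.
  apply/touchP; exists x, y; split=> //; rewrite /nonadj sep // andbT.
  by apply: contraTneq xC => ->; move: yD; rewrite inE => /andP[].
rewrite SE in mP.
have [K1 O1 E1] := matchingP _ _ m1C; have [K2 O2 E2] := matchingP _ _ m2D.
pose m := [ffun x => if x \in C then m1 x else m2 x].
have mS : matching S m.
  apply/matchingP; split=> x; rewrite !ffunE; case: (boolP (x \in C)) => xC.
  - by rewrite (matching_stable m1C xC) K1.
  - case: (boolP (m2 x \in C)) => m2C; last exact: K2.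
    have h : m2 (m2 x) = m2 x by apply: O2; rewrite inE m2C.
    by move: xC; rewrite -(K2 x) h m2C.
  - by move/negP=> []; exact: subsetP CS _ xC.
  - by move=> xS; apply: O2; rewrite inE negb_and xS orbT.
  - exact: E1.
  - exact: E2.
exists m, (P1 :|: P2); split=> //; rewrite cP.
have -> : unmatched S m = unmatched C m1 :|: unmatched (S :\: C) m2.
  apply/setP=> x; rewrite !inE ffunE; case: (boolP (x \in C)) => xC /=.
    by rewrite (subsetP CS _ xC) orbF.
  by [].
have := cardsUI (unmatched C m1) (unmatched (S :\: C) m2).
have := cardsUI C (S :\: C); rewrite SE.
by move: le1 le2; clear; lia.
Qed.

(** A vertex unrelated to [v] would let the class of [v] split [S] into two proper parts with
    matched models. So a maximum matching missing [v] misses nothing else, whence the parity and the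
    bound. *)
Lemma critical : S != set0 ->
  odd #|S| /\ forall P, model nonadj S P -> 2 * #|P| <= #|S|.
Proof.
case/set0Pn=> v vS; have [m maxm mv] := maximum_missing vS.
have [mS mm] := maximumP _ maxm.
have vu : v \in unmatched S m by rewrite inE vS mv eqxx.
have all u : u \in S -> never_both v u.
  move=> uS; apply/negPn/negP=> nvu.
  pose C := [set x in S | never_both v x].
  have CS : C \subset S by apply/subsetP=> x; rewrite inE => /andP[].
  have vC : v \in C by rewrite inE vS /never_both eqxx.
  apply: noS; apply: (matched_model_join CS).
  - move=> x y; rewrite !inE => /andP[xS vx] /andP[nvy yS].
    apply: contra nvy => xy; rewrite yS /=.
    exact: never_both_trans vS xS yS vx (never_both_edge xS yS xy).
  - apply: IH; apply/properP; split=> //; exists u => //.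
    by rewrite inE uS (negPf nvu).
  - apply: IH; apply/properP; split; first exact: subsetDl.
    by exists v; rewrite // !inE vS /never_both eqxx.
have um : unmatched S m = [set v].
  apply/setP=> u; rewrite !inE; apply/andP/eqP=> [[uS /eqP mu]|->]; last by rewrite mv.
  by have /never_bothP[->//|h] := all u uS; case: (h m).
have par := matching_parity mS; rewrite um cards1 in par.
split=> [|P mP]; first by move: par; lia.
rewrite leqNgt; apply/negP=> lt; apply: noS; exists m, P; split=> //.
by rewrite um cards1 addn1.
Qed.

End Critical.

(** Gallai's lemma as an induction principle: it suffices to treat nonempty sets of odd order, by a
    model with more than half as many branch sets as vertices. *)
Lemma matched_model_proper_ind :
  (forall S, (forall S', S' \proper S -> matched_model S') ->
     S != set0 -> odd #|S| ->
     exists2 P, model nonadj S P & #|S| < 2 * #|P|) ->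
  forall S, matched_model S.
Proof.
move=> step S; have [n] := ubnP #|S|; elim: n => // n IHn in S * => leSn.
have IH S' : S' \proper S -> matched_model S'.
  by move=> pS; apply: IHn; rewrite -ltnS; exact: leq_trans (proper_card pS) _.
have [->|S0] := eqVneq S set0.
  exists [ffun x => x], set0; split; last 1 first.
  - by rewrite !cards0 /unmatched (_ : [set x in _ | _] = set0) ?cards0 //; apply/setP=> x; rewrite !inE.
  - by apply/matchingP; split=> x; rewrite !ffunE //; left.
  - exact: model0.
have [//|noS] := pselect (matched_model S).
have [oS mS] := critical noS IH S0.
by have [P /mS] := step S IH S0 oS; rewrite leqNgt => /negP.
Qed.

End Matching.

(** The colour classes are the matched pairs and the missed vertices, each named by its
    representative. *)
Lemma matching_colorable (G : sgraph) (m : {ffun G -> G}) :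
  matching (fun x y => (x != y) && ~~ adj x y) [set: G] m ->
  colorable G #|invol_reps [set: G] m|.
Proof.
move=> /matchingP[mK _ me]; set R := invol_reps _ _.
have hR x : (if x \in R then x else m x) \in R.
  case: ifPn => // xR; move: xR; rewrite /R /invol_reps !inE mK /= -ltnNge.
  exact: ltnW.
pose c := [ffun x => enum_rank_in (hR x) (if x \in R then x else m x)].
apply/existsP; exists c; apply/forallP=> x; apply/forallP=> y; apply/implyP=> xy.
apply/negP=> /eqP; rewrite !ffunE => /(congr1 enum_val).
rewrite !enum_rankK_in // => h.
have : y = x \/ y = m x.
  move: h; case: ifP => _; case: ifP => _ => h; first by left.
  - by right; rewrite h mK.
  - by right.
  - by left; rewrite -(mK x) h mK.
case=> hy; first by rewrite hy adj_irr in xy.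
by case: (me x) => [h2|]; [rewrite hy h2 adj_irr in xy | rewrite -hy xy andbF].
Qed.

(** * Packing seagulls *)

Section Seagulls.

Variables (T : finType) (e : rel T).
Hypotheses (e_sym : symmetric e) (e_irr : irreflexive e).
Hypothesis tri : forall x y z, e x y -> e y z -> ~~ e x z.
Implicit Types (S X Y K L W G : {set T}).

Local Notation nadj := (nonadj e).

Definition indep X : bool := [forall x in X, forall y in X, ~~ e x y].

Lemma indepP X : reflect {in X &, forall x y, ~~ e x y} (indep X).
Proof.
apply: (iffP forall_inP) => [h x y xX yX|h x xX]; first exact: (forall_inP (h x xX)).
by apply/forall_inP=> y yX; exact: h.
Qed.

Lemma indep_neighbours x X : {in X, forall y, e x y} -> indep X.
Proof.
move=> h; apply/indepP=> y z yX zX; apply: (@tri _ x); rewrite ?h //.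
by rewrite e_sym h.
Qed.

Lemma indepU1 x X : {in X, forall y, ~~ e x y} -> indep X -> indep (x |: X).
Proof.
move=> h /indepP iX; apply/indepP=> y z; rewrite !inE.
case/orP=> [/eqP->|yX] /orP[/eqP->|zX]; rewrite ?e_irr ?h //; last exact: iX.
by rewrite e_sym h.
Qed.

Lemma indep_sub X Y : X \subset Y -> indep Y -> indep X.
Proof.
move=> /subsetP s /indepP iY; apply/indepP=> x y xX yX.
by apply: iY; apply: s.
Qed.

(** For the adjacency [nadj] this is an induced path from [a] to [c] with middle vertex [b]. *)
Definition gull a c b := [&& e a c, ~~ e a b & ~~ e c b].

Definition seagull G := [exists a, exists c, exists b, gull a c b && (G == [set a; c; b])].

Lemma seagullP G :
  reflect (exists a c b, gull a c b /\ G = [set a; c; b]) (seagull G).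
Proof.
apply: (iffP existsP) => [[a /existsP[c /existsP[b /andP[g /eqP->]]]]|[a [c [b [g ->]]]]].
  by exists a, c, b.
by exists a; apply/existsP; exists c; apply/existsP; exists b; rewrite g eqxx.
Qed.

Lemma gull_neq a c b : gull a c b -> [/\ a != c, a != b & c != b].
Proof.
case/and3P=> ac ab cb; split; first by apply: contraTneq ac => ->; rewrite e_irr.
  by apply: contraNneq cb => <-; rewrite e_sym.
by apply: contraNneq ab => <-.
Qed.

Lemma gullC a c b : gull a c b -> gull c a b.
Proof. by case/and3P=> ac ab cb; rewrite /gull e_sym ac ab cb. Qed.

Lemma card_seagull G : seagull G -> #|G| = 3.
Proof.
case/seagullP=> a [c [b [g ->]]]; have [ac ab cb] := gull_neq g.
by rewrite -setUA cardsU1 cards2 !inE negb_or ac ab cb.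
Qed.

Lemma seagull_connected G : seagull G -> connected_set nadj G.
Proof.
case/seagullP=> a [c [b [g ->]]]; have [nac nab ncb] := gull_neq g.
case/and3P: g => ac ab cb.
have na : nadj b a by rewrite /nonadj eq_sym nab e_sym.
have nc : nadj b c by rewrite /nonadj eq_sym ncb e_sym.
split=> [|X XG X0 XnG]; first by apply/set0Pn; exists a; rewrite !inE eqxx.
have nb y : y \in [set a; c; b] -> y != b -> nadj b y.
  by rewrite !inE -orbA => /or3P[] /eqP-> //; rewrite eqxx.
apply/touchP; case: (boolP (b \in X)) => bX.
  have [y yG yX] : exists2 y, y \in [set a; c; b] & y \notin X.
    by apply/subsetPn; apply: contra XnG => h; rewrite eqEsubset XG.
  exists b, y; rewrite bX in_setD yX yG; split=> //; apply: nb => //.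
  by apply: contraNneq yX => ->.
have [x xX] := set0Pn _ X0; exists x, b; rewrite xX in_setD bX; split=> //.
  by rewrite !inE eqxx !orbT.
rewrite nonadj_sym // nb ?(subsetP XG) //.
by apply: contraNneq bX => <-.
Qed.

(** By triangle-freeness no vertex is [e]-adjacent to both ends of the [e]-edge. *)
Lemma seagull_dominating G x : seagull G -> x \notin G -> exists2 y, y \in G & nadj y x.
Proof.
case/seagullP=> a [c [b [/and3P[ac _ _] ->]]]; rewrite !inE !negb_or -andbA.
case/and3P=> xa xc _; case: (boolP (e a x)) => ax.
  exists c; rewrite ?inE ?eqxx ?orbT // /nonadj eq_sym xc /=.
  by rewrite (@tri _ a) // e_sym.
by exists a; rewrite ?inE ?eqxx // /nonadj eq_sym xa.
Qed.

(** Removing each seagull from [S] before the next is placed encodes disjointness from one another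
    and from [K]. *)
Fixpoint packing S K (Gs : seq {set T}) : bool :=
  if Gs is G :: Gs' then [&& seagull G, G \subset S & packing (S :\: G) K Gs']
  else K \subset S.

(** The vertices of [K] are singleton branch sets; each seagull, connected and dominating, is one
    more. *)
Lemma packing_model S K Gs : indep K -> packing S K Gs ->
  exists2 P, model nadj S P & #|P| = #|K| + size Gs.
Proof.
move=> iK; elim: Gs S => [|G Gs IH] S /=.
  move=> KS; have cK : {in K &, forall x y, x != y -> nadj x y}.
    by move=> x y xK yK xy; rewrite /nonadj xy (indepP _ iK).
  have [mP cP] := model_clique cK.
  by exists [set [set x] | x in K]; rewrite ?addn0 //; exact: model_sub KS mP.
case/and3P=> gG GS /IH[P mP cP].
have dom x : x \in S :\: G -> exists2 y, y \in G & nadj y x.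
  by rewrite inE => /andP[xG _]; exact: seagull_dominating.
have [mQ cQ] := model_dominating (nonadj_sym e_sym) (seagull_connected gG) GS dom mP.
by exists (G |: P); rewrite // cQ cP addnS.
Qed.

(* A seagull-free X is independent or complete bipartite; by triangle-freeness
   the sides of the latter can be distributed over the two sides of K. *)
Lemma seagull_free_bipartition K X : indep K -> [disjoint K & X] ->
    (forall G, seagull G -> ~~ (G \subset X)) ->
  exists Y Z, [/\ indep Y, indep Z, [disjoint Y & Z] & Y :|: Z = K :|: X].
Proof.
move=> iK dKX free; case: (boolP (indep X)) => [iX|]; first by exists K, X.
case/forall_inPn=> a aX /forall_inPn[c cX]; rewrite negbK => ac.
have free3 x y z : x \in X -> y \in X -> z \in X -> ~~ gull x y z.
  move=> xX yX zX; apply/negP=> g.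
  have gG : seagull [set x; y; z] by apply/seagullP; exists x, y, z.
  case/negP: (free _ gG).
  by apply/subsetP=> w; rewrite !inE -orbA => /or3P[] /eqP->.
have ca : e c a by rewrite e_sym.
(* Otherwise [a], [c], [x] would be a seagull; for a similar reason [A] and [B] below are completely
   joined. *)
have aorc x : x \in X -> e a x || e c x.
  move=> xX; have := free3 a c x aX cX xX.
  by rewrite /gull ac /= -negb_or negbK.
pose A := [set x in X | e c x]; pose B := [set x in X | e a x].
have compl x y : x \in A -> y \in B -> e x y.
  rewrite !inE => /andP[xX cx] /andP[yX ay].
  have := free3 x c y xX cX yX; rewrite /gull e_sym cx /=.
  by rewrite (tri ca ay) andbT negbK.
have iA : indep A by apply: (@indep_neighbours c) => z; rewrite inE => /andP[].
have iB : indep B by apply: (@indep_neighbours a) => z; rewrite inE => /andP[].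
(* A vertex of [K] with an [e]-neighbour in [A] has none in [B], so it joins [B]; the others join
   [A]. *)
pose KA := [set k in K | [exists x in A, e k x]].
have KAS : KA \subset K by apply/subsetP=> k; rewrite inE => /andP[].
exists (B :|: KA), (A :|: (K :\: KA)); split.
- apply/indepP=> x y; rewrite !in_setU => /orP[xB|xK] /orP[yB|yK].
  + exact: (indepP _ iB).
  + move: yK; rewrite inE => /andP[yK /exists_inP[z zA yz]].
    by rewrite e_sym (tri yz) // compl.
  + move: xK; rewrite inE => /andP[xK /exists_inP[z zA xz]].
    by rewrite (tri xz) // compl.
  + by apply: (indepP _ iK); exact: subsetP KAS _ _.
- apply/indepP=> x y; rewrite !in_setU => /orP[xA|xK] /orP[yA|yK].
  + exact: (indepP _ iA).
  + move: yK; rewrite in_setD inE => /andP[h yK]; rewrite yK /= in h.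
    by move/exists_inPn: h => /(_ x xA); rewrite e_sym.
  + move: xK; rewrite in_setD inE => /andP[h xK]; rewrite xK /= in h.
    by move/exists_inPn: h => /(_ y yA).
  + by move: xK yK; rewrite !in_setD => /andP[_ xK] /andP[_ yK]; exact: (indepP _ iK).
- apply/pred0P=> x /=; rewrite !in_setU in_setD; apply/negP=> /andP[].
  have XK : x \in X -> x \notin K by move=> xX; rewrite (disjointFl dKX xX).
  case/orP=> [xB|xK] /orP[xA|/andP[nK xK']].
  + move: xA xB; rewrite !inE => /andP[_ cx] /andP[_].
    by rewrite (negPf (tri ac cx)).
  + by move: xB; rewrite inE => /andP[/XK]; rewrite xK'.
  + by move: xA xK; rewrite !inE => /andP[/XK/negPf->].
  + by rewrite xK in nK.
- apply/setP=> x; rewrite !in_setU in_setD; case: (boolP (x \in X)) => xX.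
    by rewrite !inE xX /=; case/orP: (aorc x xX) => ->; rewrite ?orbT.
  have -> : (x \in B) = false by rewrite inE (negPf xX).
  have -> : (x \in A) = false by rewrite inE (negPf xX).
  rewrite /= orbF; case: (boolP (x \in KA)) => //= xKA.
  by rewrite (subsetP KAS).
Qed.

End Seagulls.

(** * Exchanges between a seagull and an independent set *)

Section Augment.

Variables (T : finType) (e : rel T).
Hypotheses (e_sym : symmetric e) (e_irr : irreflexive e).
Hypothesis tri : forall x y z, e x y -> e y z -> ~~ e x z.
Implicit Types (S X Y K L W G : {set T}).

Local Notation nadj := (nonadj e).
Local Notation gull := (gull e).
Local Notation seagull := (seagull e).
Local Notation indep := (indep e).

Definition two_seagulls X : Prop :=
  exists G1 G2, [/\ seagull G1, seagull G2, [disjoint G1 & G2], G1 \subset X & G2 \subset X].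

Lemma two_seagullsI X x1 x2 x3 y1 y2 y3 :
    gull x1 x2 x3 -> gull y1 y2 y3 ->
    uniq [:: x1; x2; x3; y1; y2; y3] ->
    [&& x1 \in X, x2 \in X, x3 \in X, y1 \in X, y2 \in X & y3 \in X] ->
  two_seagulls X.
Proof.
move=> g1 g2 u /and5P[h1 h2 h3 h4 /andP[h5 h6]]; exists [set x1; x2; x3], [set y1; y2; y3]; split.
- by apply/seagullP; exists x1, x2, x3.
- by apply/seagullP; exists y1, y2, y3.
- apply/pred0P=> z /=; rewrite !inE; apply/negP=> /andP[k1 k2].
  move: u; rewrite -[_ :: _]/([:: x1; x2; x3] ++ [:: y1; y2; y3]) cat_uniq.
  case/and3P=> _ /hasPn/(_ z) + _; rewrite !inE orbA k2 => /(_ isT).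
  by rewrite orbA k1.
- by apply/subsetP=> z; rewrite !inE => /orP[/orP[]|] /eqP->.
- by apply/subsetP=> z; rewrite !inE => /orP[/orP[]|] /eqP->.
Qed.

Lemma pick2 L (u v : T) : 4 <= #|L| ->
  exists x y, [/\ x \in L, y \in L, x != y & [/\ x != u, x != v, y != u & y != v]].
Proof.
move=> L4; have : 1 < #|L :\ u :\ v|.
  move: L4; rewrite (cardsD1 u) (cardsD1 v (L :\ u)).
  by case: (u \in L); case: (v \in _); clear; lia.
case/card_gt1P=> x [y []]; rewrite !inE => /and3P[? ? ?] /and3P[? ? ?] ?.
by exists x, y.
Qed.

Lemma pick1 L (u v : T) : 4 <= #|L| -> exists x, [/\ x \in L, x != u & x != v].
Proof. by case/(pick2 u v) => x [y [xL _ _ [? ? _ _]]]; exists x. Qed.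

Ltac side h := first [done | by rewrite eq_sym | by apply: h | by rewrite eq_sym; apply: h].

Section Triple.

Variables (L : {set T}) (a c b : T).
Hypotheses (iL : indep L) (L4 : 4 <= #|L|) (g : gull a c b).
Hypotheses (aL : a \notin L) (cL : c \notin L) (bL : b \notin L).

Let U := [set a; c; b] :|: L.

Let UL x : x \in L -> x \in U.
Proof. by rewrite !inE => ->; rewrite orbT. Qed.
Let Ua : a \in U. Proof. by rewrite !inE eqxx. Qed.
Let Uc : c \in U. Proof. by rewrite !inE eqxx orbT. Qed.
Let Ub : b \in U. Proof. by rewrite !inE eqxx !orbT. Qed.

Let LL x y : x \in L -> y \in L -> ~~ e x y. Proof. exact: (indepP _ _ iL). Qed.

Let neL x y : x \in L -> y \notin L -> x != y.
Proof. by move=> xL; apply: contraNneq => <-. Qed.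

Ltac neq := first [assumption | rewrite eq_sym; assumption
  | by apply: neL | by rewrite eq_sym; apply: neL].
Ltac six := rewrite /= ?in_cons ?in_nil ?negb_or; repeat (apply/andP; split); first [done | neq | by apply: UL].
Ltac gul := apply/and3P; split; first [assumption | rewrite e_sym; assumption
  | by apply: LL | idtac].

(** Triangle-freeness keeps [yc] from [a], and [z1], [z2] from [c]. The choice of seagulls depends
    on whether [b] misses one of [z1], [z2] or sees both. *)
Lemma both_attached yc z1 z2 : yc \in L -> e c yc -> z1 \in L -> z2 \in L -> z1 != z2 ->
  e a z1 -> e a z2 -> two_seagulls U.
Proof.
move=> ycL cyc z1L z2L z12 az1 az2; have [nac nab ncb] := gull_neq e_sym e_irr g.
have /and3P[ac ab cb] := g.
have ca : e c a by rewrite e_sym.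
have nayc : ~~ e a yc by apply: tri cyc.
have ncz z : e a z -> ~~ e c z by move=> az; apply: tri az.
have ne1 : yc != z1 by apply: contraNneq nayc => ->.
have ne2 : yc != z2 by apply: contraNneq nayc => ->.
case: (boolP (e b z1)) => bz1; last first.
  by apply: (@two_seagullsI U a z1 b c yc z2); [gul|gul; exact: ncz|six|six].
case: (boolP (e b z2)) => bz2; last first.
  by apply: (@two_seagullsI U a z2 b c yc z1); [gul|gul; exact: ncz|six|six].
by apply: (@two_seagullsI U a z1 yc b z2 c); [gul|gul; rewrite e_sym; exact: ncz|six|six].
Qed.

Lemma unattached z y y' : {in L, forall x, ~~ e c x} ->
  z \in L -> y \in L -> y' \in L -> z != y -> z != y' -> y != y' ->
  e b z -> e a y -> ~~ e a y' -> two_seagulls U.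
Proof.
move=> cf zL yL y'L zy zy' yy' bz ay ay'; have [nac nab ncb] := gull_neq e_sym e_irr g.
have /and3P[ac ab cb] := g; have cz := cf z zL.
by apply: (@two_seagullsI U a y y' b z c); [gul|gul|six|six].
Qed.

Lemma unattached' z y y' : {in L, forall x, ~~ e c x} ->
  z \in L -> y \in L -> y' \in L -> z != y -> z != y' -> y != y' ->
  e b z -> ~~ e a y -> ~~ e b y' -> two_seagulls U.
Proof.
move=> cf zL yL y'L zy zy' yy' bz ay by'; have [nac nab ncb] := gull_neq e_sym e_irr g.
have /and3P[ac ab cb] := g; have cy := cf y yL.
by apply: (@two_seagullsI U a c y b z y'); [gul|gul|six|six].
Qed.

(* A star with centre h and leaf set L', and a disjoint edge f1 f2: it has no two
   disjoint seagulls, but it can be repacked as the seagull f1, f2, h and L'. *)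
Definition star_swap : Prop := exists t h f1 f2 L',
  [/\ t \in [set a; c; b], {in L, forall y, ~~ e t y},
      gull f1 f2 h /\ indep L', #|L'| = #|L|
    & [/\ {in L', forall y, e h y}, {in L', forall y, ~~ e f1 y},
          {in L', forall y, ~~ e f2 y}, [disjoint [set f1; f2; h] & L']
        & [set f1; f2; h] :|: L' = U]].

(** The outcomes of a local exchange: the packing grows, [L] grows by two vertices, or the
    configuration has the rigid shape of a star plus an edge. *)
Definition augmentation : Prop :=
  [\/ two_seagulls U,
      exists x y, [/\ x \in [set a; c; b], y \in [set a; c; b], x != y
                  & indep (x |: (y |: L))]
    | star_swap].

(** A neighbour [z] of [b] in [L] is fixed. Two seagulls come from [unattached] or [unattached']
    unless [a] and [b] are each joined to almost all or almost none of [L]. *)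
Lemma augment_unattached : {in L, forall x, ~~ e c x} ->
  (exists2 y, y \in L & ~~ e a y) -> augmentation.
Proof.
move=> cf [y0 y0L ay0]; have [nac nab ncb] := gull_neq e_sym e_irr g.
have /and3P[ac ab cb] := g.
have dL x1 x2 x3 : x1 \notin L -> x2 \notin L -> x3 \notin L -> [disjoint [set x1; x2; x3] & L].
  move=> h1 h2 h3; apply/pred0P=> x /=; rewrite !inE; apply/negP=> /andP[].
  by move=> /orP[/orP[]|] /eqP->; apply/negP.
case: (boolP [exists z in L, e b z]) => [/exists_inP[z zL bz]|/exists_inPn bf]; last first.
  constructor 2; exists c, b; rewrite !inE !eqxx !orbT ncb; split=> //.
  apply: indepU1 => //; last exact: indepU1.
  by move=> x; rewrite !inE => /orP[/eqP->|/cf].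
case: (boolP [exists y in L, e a y]) => [/exists_inP[y yL ay]|/exists_inPn af]; last first.
  case: (boolP [exists y' in L, ~~ e b y']) => [/exists_inP[y' y'L by']|/exists_inPn bf].
    have [y [yL yz yy']] := pick1 z y' L4.
    have zy' : z != y' by apply: contraTneq bz => ->.
    by constructor 1; apply: (@unattached' z y y'); side af.
  (* Here [b] sees all of [L] while [a] and [c] see none of it: the star has centre [b] and the edge
     is [a], [c]. *)
  constructor 3; exists a, b, a, c, L; rewrite !inE eqxx; split=> //.
  split=> //; last exact: dL.
  by move=> y yL; have := bf y yL; rewrite negbK.
have ay_neq u w : e a u -> ~~ e a w -> u != w by move=> au; apply: contraNneq => <-.
case: (boolP (e a z)) => az.
  case: (boolP [exists y2 in L, (y2 != z) && e a y2]) => [/exists_inP[y2 y2L /andP[y2z ay2]]|/exists_inPn h].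
    by constructor 1; apply: (@unattached z y2 y0); side ay_neq.
  have af w : w \in L -> w != z -> ~~ e a w.
    by move=> wL wz; have := h w wL; rewrite wz.
  case: (boolP [exists y' in L, (y' != z) && ~~ e b y']) => [/exists_inP[y' y'L /andP[y'z by']]|/exists_inPn h'].
    have [w [wL wz wy']] := pick1 z y' L4.
    by constructor 1; apply: (@unattached' z w y'); side af.
  have [z2 [w [z2L wL z2w [z2z _ wz _]]]] := pick2 z z L4.
  have bz2 : e b z2 by have := h' z2 z2L; rewrite z2z negbK.
  by constructor 1; apply: (@unattached z2 z w); side af.
case: (boolP [exists y2 in L, (y2 != z) && ~~ e a y2]) => [/exists_inP[y2 y2L /andP[y2z ay2]]|/exists_inPn h].
  by constructor 1; apply: (@unattached z y y2); side ay_neq.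
have af w : w \in L -> w != z -> e a w.
  by move=> wL wz; have := h w wL; rewrite wz negbK.
case: (boolP [exists z2 in L, (z2 != z) && e b z2]) => [/exists_inP[z2 z2L /andP[z2z bz2]]|/exists_inPn h'].
  have [w [wL wz wz2]] := pick1 z z2 L4.
  by constructor 1; apply: (@unattached z2 w z); side af.
have bf w : w \in L -> w != z -> ~~ e b w.
  by move=> wL wz; have := h' w wL; rewrite wz.
(* Here [a] sees all of [L] but [z], and [b] sees only [z] there: the star has centre [a] with [c]
   as a new leaf, and the edge is [b], [z]. *)
constructor 3; exists c, a, b, z, (c |: (L :\ z)); rewrite !inE eqxx orbT; split=> //.
- split; first by apply/and3P; split; rewrite // e_sym.
  apply: indepU1 => // [x|]; first by rewrite !inE => /andP[_ /cf].
  by apply: indep_sub iL; exact: subsetDl.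
- by rewrite cardsU1 !inE (negPf cL) andbF (cardsD1 z L) zL.
split.
- by move=> x; rewrite !inE => /orP[/eqP->|/andP[xz xL]] //; exact: af.
- move=> x; rewrite !inE => /orP[/eqP->|/andP[xz xL]]; last exact: bf.
  by rewrite e_sym.
- move=> x; rewrite !inE => /orP[/eqP->|/andP[xz xL]]; last exact: LL.
  by rewrite e_sym cf.
- have nz w : w \notin L -> w != z by move=> wL; rewrite eq_sym neL.
  apply/pred0P=> x /=; rewrite !inE; apply/negP=> /andP[].
  move=> /orP[/orP[]|] /eqP->; rewrite ?eqxx ?(negPf aL) ?(negPf bL) ?andbF ?orbF.
  + by rewrite eq_sym (negPf ncb).
  + by rewrite eq_sym (negPf (nz _ cL)).
  + by rewrite (negPf nac).
- apply/setP=> x; rewrite !inE; have [->|xz] := eqVneq x z; first by rewrite zL !orbT.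
  by case: (x == a); case: (x == b); case: (x == c); case: (x \in L).
Qed.

End Triple.

(** If [a] or [c] has no neighbour in [L], [augment_unattached] applies; if both have one, two
    seagulls always exist. *)
Lemma augment L a c b : indep L -> 4 <= #|L| -> gull a c b ->
    [disjoint [set a; c; b] & L] ->
    (exists2 y, y \in L & ~~ e a y) -> (exists2 y, y \in L & ~~ e c y) ->
  augmentation L a c b.
Proof.
move=> iL L4 g dL na nc; have /and3P[ac ab cb] := g.
have aL : a \notin L by rewrite (disjointFr dL) // !inE eqxx.
have cL : c \notin L by rewrite (disjointFr dL) // !inE eqxx orbT.
have bL : b \notin L by rewrite (disjointFr dL) // !inE eqxx !orbT.
have ca : e c a by rewrite e_sym.
case: (boolP [exists y in L, e c y]) => [/exists_inP[yc ycL cyc]|/exists_inPn cf]; last first.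
  exact: augment_unattached.
have swap : [set c; a; b] = [set a; c; b] by rewrite [[set c; a]]setUC.
case: (boolP [exists y in L, e a y]) => [/exists_inP[ya yaL aya]|/exists_inPn af]; last first.
  have := augment_unattached iL L4 (gullC e_sym g) cL aL bL af nc.
  by rewrite /augmentation /star_swap swap.
constructor 1.
(* Neither vertex is joined to both [a] and [c]. So either they complete seagulls on [a], [ya] and
   on [c], [yc], or one of [a], [c] sees both of them. *)
have [z1 [z2 [z1L z2L z12 [z1a z1c z2a z2c]]]] := pick2 ya yc L4.
have excl z : e a z -> ~~ e c z by move=> az; apply: tri az.
have [nac nab ncb] := gull_neq e_sym e_irr g.
have neL x y : x \in L -> y \notin L -> x != y by move=> xL; apply: contraNneq => <-.
have LL x y : x \in L -> y \in L -> ~~ e x y by exact: (indepP _ _ iL).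
have yac : ya != yc by apply: contraTneq cyc => <-; exact: excl.
have key u w : u \in L -> w \in L -> u != w -> u != ya -> u != yc -> w != ya -> w != yc ->
    ~~ e a u -> ~~ e c w -> two_seagulls ([set a; c; b] :|: L).
  move=> uL wL uw uya uyc wya wyc au cw.
  apply: (@two_seagullsI _ a ya u c yc w).
  - by apply/and3P; split=> //; exact: LL.
  - by apply/and3P; split=> //; exact: LL.
  - rewrite /= !in_cons !in_nil !negb_or.
    by repeat (apply/andP; split); first [done | assumption | rewrite eq_sym; assumption
      | by apply: neL | by rewrite eq_sym; apply: neL].
  - by rewrite !in_setU yaL uL ycL wL !inE !eqxx !orbT.
case: (boolP (e a z1)) => az1; case: (boolP (e a z2)) => az2.
- exact: (@both_attached L a c b iL g aL cL bL yc z1 z2).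
- by apply: (key z2 z1); side excl.
- by apply: (key z1 z2); side excl.
case: (boolP (e c z2)) => cz2; last by apply: (key z1 z2); side excl.
case: (boolP (e c z1)) => cz1; last by apply: (key z2 z1); side excl.
rewrite -swap.
exact: (@both_attached L c a b iL (gullC e_sym g) cL aL bL ya z1 z2).
Qed.

End Augment.

(** * Packing one, two or three seagulls beside a maximum independent set *)

Section Packing.

Variables (T : finType) (e : rel T).
Hypotheses (e_sym : symmetric e) (e_irr : irreflexive e).
Hypothesis tri : forall x y z, e x y -> e y z -> ~~ e x z.

Local Notation nadj := (nonadj e).
Local Notation gull := (gull e).
Local Notation seagull := (seagull e).
Local Notation indep := (indep e).

Variables (S : {set T}) (s : nat).
Hypothesis alpha : forall X : {set T}, X \subset S -> indep X -> #|X| <= s.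
Implicit Types (X Y K L W G : {set T}).

Lemma max_attached X x : X \subset S -> indep X -> #|X| = s -> x \in S -> x \notin X ->
  exists2 y, y \in X & e x y.
Proof.
move=> XS iX cX xS xX; case: (boolP [exists y in X, e x y]) => [/exists_inP//|/exists_inPn h].
have xXS : x |: X \subset S by rewrite subUset sub1set xS.
have := alpha xXS (indepU1 e_sym e_irr h iX).
by rewrite cardsU1 xX cX; clear; lia.
Qed.

(** If [x] saw all of [L], then [L], [c] and a neighbour of [x] in [X] would form an independent set
    of size above [s]. *)
Lemma tight_nonadj L X x c : X \subset S -> indep X -> #|X| = s ->
    L \subset S -> [disjoint X & L] -> s <= #|L|.+1 ->
    x \in S -> x \notin X -> c \in S -> c \notin X -> c \notin L -> e x c ->
  exists2 y, y \in L & ~~ e x y.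
Proof.
move=> XS iX cX LS dXL sL xS xX cS nX nL xc.
case: (boolP [exists y in L, ~~ e x y]) => [/exists_inP//|/exists_inPn h].
have [y yX xy] := max_attached XS iX cX xS xX.
have yL : y \notin L by rewrite (disjointFr dXL yX).
have iN : indep (c |: (y |: L)).
  apply: (indep_neighbours e_sym tri (x := x)) => z; rewrite !inE.
  by case/or3P=> [/eqP->|/eqP->|/h] //; rewrite negbK.
have sN : c |: (y |: L) \subset S by rewrite !subUset !sub1set cS (subsetP XS) ?LS.
have yc : c != y by apply: contraNneq nX => ->.
have := alpha sN iN; rewrite cardsU1 cardsU1 yL !inE (negPf yc) (negPf nL).
by move: sL; clear; lia.
Qed.

(** A seagull-free [W] would make [K :|: W] a union of two independent sets, of size at most
    [2 * s]. *)
Lemma find_seagull K W : indep K -> K \subset S -> W \subset S -> [disjoint K & W] ->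
  2 * s < #|K| + #|W| -> exists2 G, seagull G & G \subset W.
Proof.
move=> iK KS WS dKW lt; case: (boolP [exists G in seagull, G \subset W]) => [/exists_inP//|/exists_inPn h].
have [Y [Z [iY iZ dYZ YZ]]] := seagull_free_bipartition e_sym tri iK dKW h.
have YZS : Y :|: Z \subset S by rewrite YZ subUset KS.
have := alpha (subset_trans (subsetUl _ _) YZS) iY.
have := alpha (subset_trans (subsetUr _ _) YZS) iZ.
have e1 := cardsUI Y Z; have e2 := cardsUI K W.
have d1 : #|Y :&: Z| = 0 by apply/eqP; rewrite cards_eq0 setI_eq0.
have d2 : #|K :&: W| = 0 by apply/eqP; rewrite cards_eq0 setI_eq0.
by move: lt e1 e2 d1 d2; rewrite YZ; clear; lia.
Qed.

Lemma augment_max X L a c b : X \subset S -> indep X -> #|X| = s ->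
    L \subset S -> indep L -> 4 <= #|L| -> s <= #|L|.+1 -> [disjoint X & L] ->
    gull a c b -> [set a; c; b] \subset S -> [disjoint X & [set a; c; b]] ->
    [disjoint [set a; c; b] & L] ->
  augmentation e L a c b.
Proof.
move=> XS iX cX LS iL L4 sL dXL g GS dXG dGL.
have /and3P[ac ab cb] := g.
have aG : a \in [set a; c; b] by rewrite !inE eqxx.
have cG : c \in [set a; c; b] by rewrite !inE eqxx orbT.
have aX : a \notin X by rewrite (disjointFl dXG).
have cX' : c \notin X by rewrite (disjointFl dXG).
have aL : a \notin L by rewrite (disjointFr dGL).
have cL : c \notin L by rewrite (disjointFr dGL).
have aS := subsetP GS _ aG; have cS := subsetP GS _ cG.
apply: augment => //; first exact: (@tight_nonadj L X a c).
by apply: (@tight_nonadj L X c a); rewrite // e_sym.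
Qed.

Lemma extended_card (L D : {set T}) x y : L \subset S -> D \subset S -> [disjoint D & L] ->
  x \in D -> y \in D -> x != y -> indep (x |: (y |: L)) -> #|L|.+2 <= s.
Proof.
move=> LS DS dDL xD yD xy i; have xL : x \notin L by rewrite (disjointFr dDL).
have yL : y \notin L by rewrite (disjointFr dDL).
have sub : x |: (y |: L) \subset S.
  by rewrite !subUset !sub1set (subsetP DS) // (subsetP DS).
by have := alpha sub i; rewrite !cardsU1 yL !inE (negPf xy) (negPf xL).
Qed.

Variable K : {set T}.
Hypotheses (KS : K \subset S) (iK : indep K) (cK : #|K| = s).

Lemma packing_model_size X Gs q : indep X -> #|X| = s -> size Gs = q -> packing e S X Gs ->
  exists2 P, model nadj S P & #|P| = s + q.
Proof. by move=> iX <- <-; exact: packing_model. Qed.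

Lemma pack1 : 2 * s < #|S| -> exists2 P, model nadj S P & #|P| = s + 1.
Proof.
move=> lt; have dKR : [disjoint K & S :\: K] by rewrite disjoints_subset setCD subsetUr.
have [||G gG GR] := find_seagull iK KS _ dKR; first exact: subsetDl.
  by have := cardsID K S; rewrite (setIidPr KS) => ->.
apply: (packing_model_size (Gs := [:: G]) iK cK erefl).
move: GR; rewrite subsetD => /andP[GS dGK].
by rewrite /= gG GS subsetD KS disjoint_sym.
Qed.

(** If no second seagull is left, the [2 * s] vertices outside the first form two independent sets
    of size [s]; exchanging the first seagull with one of them gives two seagulls beside the
    other. *)
Lemma pack2 : #|S| = 2 * s + 3 -> 4 <= s -> exists2 P, model nadj S P & #|P| = s + 2.
Proof.
move=> cS s4; pose R := S :\: K.
have dKR : [disjoint K & R] by rewrite disjoints_subset setCD subsetUr.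
have cR : #|R| = s + 3.
  by have := cardsID K S; rewrite (setIidPr KS) cK cS /R; clear; lia.
have RS : R \subset S by exact: subsetDl.
have [|G1 gG1 G1R] := find_seagull iK KS RS dKR; first by rewrite cK cR; clear; lia.
have G1S := subset_trans G1R RS.
have dKG1 : [disjoint K & G1] by exact: disjointWr G1R dKR.
have dKR1 : [disjoint K & R :\: G1] by exact: disjointWr (subsetDl _ _) dKR.
case: (boolP [exists G, seagull G && (G \subset R :\: G1)]) => [|/existsPn nG].
  case/existsP=> G2 /andP[gG2 G2R].
  apply: (packing_model_size (Gs := [:: G1; G2]) iK cK erefl).
  rewrite /= gG1 G1S gG2 !subsetD KS dKG1 (disjointWr G2R dKR1).
  by move: G2R; rewrite subsetD => /andP[/subset_trans-> // ->].
have free G : seagull G -> ~~ (G \subset R :\: G1).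
  by move=> gG; have := nG G; rewrite gG.
have [Y [Z [iY iZ dYZ YZ]]] := seagull_free_bipartition e_sym tri iK dKR1 free.
have YZE : Y :|: Z = S :\: G1.
  rewrite YZ; apply/setP=> x; rewrite !inE; case: (boolP (x \in K)) => xK.
    by rewrite (disjointFr dKG1 xK) (subsetP KS).
  by [].
have YZS : Y :|: Z \subset S by rewrite YZE subsetDl.
have YS := subset_trans (subsetUl _ _) YZS; have ZS := subset_trans (subsetUr _ _) YZS.
have dYZG : [disjoint Y :|: Z & G1] by rewrite YZE disjoint_sym disjoints_subset setCD subsetUr.
have dYG := disjointWl (subsetUl _ _) dYZG; have dZG := disjointWl (subsetUr _ _) dYZG.
have [cY cZ] : #|Y| = s /\ #|Z| = s.
  have := alpha YS iY; have := alpha ZS iZ.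
  have e1 := cardsUI Y Z; have e2 := cardsID G1 S.
  have d1 : #|Y :&: Z| = 0 by apply/eqP; rewrite cards_eq0 setI_eq0.
  rewrite (setIidPr G1S) (card_seagull e_sym e_irr gG1) -YZE in e2.
  by move: cS e1 e2 d1; clear; lia.
have /seagullP[a [c [b [g G1E]]]] := gG1; subst G1.
have dGZ : [disjoint [set a; c; b] & Z] by rewrite disjoint_sym.
have dYGZ : [disjoint Y & [set a; c; b] :|: Z].
  by rewrite -setI_eq0 setIUr setU_eq0 !setI_eq0 dYG dYZ.
have GZS : [set a; c; b] :|: Z \subset S by rewrite subUset G1S.
have [] : augmentation e Z a c b by apply: (augment_max YS iY cY ZS iZ); rewrite ?cZ.
- case=> G2 [G3 [gG2 gG3 dG sG2 sG3]].
  apply: (packing_model_size (Gs := [:: G2; G3]) iY cY erefl).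
  rewrite /= gG2 gG3 (subset_trans sG2 GZS) !subsetD (subset_trans sG3 GZS) YS.
  by rewrite (disjointWr sG2 dYGZ) (disjointWr sG3 dYGZ) disjoint_sym dG.
- case=> x [y [xG yG xy i]]; have := extended_card ZS G1S dGZ xG yG xy i.
  by rewrite cZ; clear; lia.
- case=> t [h [f1 [f2 [L' [_ _ [_ iL'] cL' [hL' _ _ dL' LE]]]]]].
  have hU : h \in [set a; c; b] :|: Z by rewrite -LE !inE eqxx orbT.
  have hY : h \notin Y by rewrite (disjointFl dYGZ).
  (* The centre [h] sees all of [L'] and also some [y] in [Y], which gives an independent set of
     size [s + 1]. *)
  have [y yY hy] := max_attached YS iY cY (subsetP GZS _ hU) hY.
  have L'U : L' \subset [set a; c; b] :|: Z by rewrite -LE subsetUr.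
  have yL' : y \notin L' by rewrite (disjointFr (disjointWr L'U dYGZ) yY).
  have iN : indep (y |: L').
    apply: (indep_neighbours e_sym tri (x := h)) => z; rewrite !inE.
    by case/orP=> [/eqP->|/hL'].
  have sN : y |: L' \subset S by rewrite subUset sub1set (subsetP YS) // (subset_trans L'U).
  by have := alpha sN iN; rewrite cardsU1 yL' cL' cZ; clear; lia.
Qed.

Lemma disjointUr (A B C : {set T}) :
  [disjoint A & B :|: C] = [disjoint A & B] && [disjoint A & C].
Proof. by rewrite -!setI_eq0 setIUr setU_eq0. Qed.

(** First [G1] is exchanged with [Y]. In the star case they are repacked as a new seagull and an
    independent set of the same size, with which [G2] is exchanged in turn. *)
Lemma pack3_bipartition X Y G1 G2 :
    X \subset S -> indep X -> #|X| = s -> Y \subset S -> indep Y -> #|Y|.+1 = s -> 5 <= s ->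
    [disjoint X & Y] -> seagull G1 -> seagull G2 -> G1 \subset S -> G2 \subset S ->
    [disjoint G1 & G2] -> [disjoint X & G1] -> [disjoint X & G2] ->
    [disjoint G1 & Y] -> [disjoint G2 & Y] ->
  exists2 P, model nadj S P & #|P| = s + 3.
Proof.
move=> XS iX cX YS iY cY s5 dXY gG1 gG2 G1S G2S dG dX1 dX2 d1Y d2Y.
have Y4 : 3 < #|Y| by rewrite -ltnS cY.
have /seagullP[a [c [b [g G1E]]]] := gG1; subst G1.
have UYS : [set a; c; b] :|: Y \subset S by rewrite subUset G1S.
have dXU : [disjoint X & [set a; c; b] :|: Y] by rewrite disjointUr dX1.
have d2U : [disjoint G2 & [set a; c; b] :|: Y] by rewrite disjointUr disjoint_sym dG.
have [] : augmentation e Y a c b by apply: (augment_max XS iX cX YS iY); rewrite ?cY.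
- case=> G3 [G4 [gG3 gG4 d34 s3 s4]].
  apply: (packing_model_size (Gs := [:: G2; G3; G4]) iX cX erefl).
  rewrite /= gG2 gG3 gG4 G2S !subsetD XS (subset_trans s3 UYS) (subset_trans s4 UYS).
  rewrite dX2 (disjointWr s3 dXU) (disjointWr s4 dXU) [[disjoint G4 & G3]]disjoint_sym d34.
  by rewrite ![[disjoint _ & G2]]disjoint_sym (disjointWr s3 d2U) (disjointWr s4 d2U).
- case=> x [y [xG yG xy i]]; have := extended_card YS G1S d1Y xG yG xy i.
  by rewrite cY ltnn.
case=> _ [h [f1 [f2 [L [_ _ [gf iL] cL [hL f1L f2L dfL LE]]]]]].
have /and3P[f12 _ _] := gf.
set F := [set f1; f2; h] in dfL LE.
have gF : seagull F by apply/seagullP; exists f1, f2, h.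
have FS : F \subset S by apply: subset_trans UYS; rewrite -LE subsetUl.
have LS : L \subset S by apply: subset_trans UYS; rewrite -LE subsetUr.
move: dXU; rewrite -LE disjointUr => /andP[dXF dXL].
move: d2U; rewrite -LE disjointUr => /andP[d2F d2L].
have /seagullP[a2 [c2 [b2 [g2 G2E]]]] := gG2; subst G2.
have ULS : [set a2; c2; b2] :|: L \subset S by rewrite subUset G2S.
have dXU : [disjoint X & [set a2; c2; b2] :|: L] by rewrite disjointUr dX2.
have dFU : [disjoint F & [set a2; c2; b2] :|: L] by rewrite disjointUr disjoint_sym d2F.
have [] : augmentation e L a2 c2 b2.
  by apply: (augment_max XS iX cX LS iL); rewrite ?cL ?cY.
- case=> G3 [G4 [gG3 gG4 d34 s3 s4]].
  apply: (packing_model_size (Gs := [:: F; G3; G4]) iX cX erefl).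
  rewrite /= gF gG3 gG4 FS !subsetD XS (subset_trans s3 ULS) (subset_trans s4 ULS).
  rewrite dXF (disjointWr s3 dXU) (disjointWr s4 dXU) [[disjoint G4 & G3]]disjoint_sym d34.
  by rewrite ![[disjoint _ & F]]disjoint_sym (disjointWr s3 dFU) (disjointWr s4 dFU).
- case=> x [y [xG yG xy i]]; have := extended_card LS G2S d2L xG yG xy i.
  by rewrite cL cY ltnn.
case=> t [_ [_ [_ [_ [tG tL _ _ _]]]]].
(* After a second star case [t], [f1] and [f2] all see nothing of [L], and [t] misses [f1] or [f2]:
   an independent set of size [s + 1]. *)
have [f [fF fL tf]] : exists f, [/\ f \in F, {in L, forall y, ~~ e f y} & ~~ e t f].
  case: (boolP (e t f1)) => tf1; last by exists f1; rewrite !inE eqxx.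
  by exists f2; rewrite !inE eqxx orbT; split=> //; exact: tri f12.
have itf : indep (t |: (f |: L)).
  apply: indepU1 => //; last exact: indepU1.
  by move=> y; rewrite !inE => /orP[/eqP->|/tL].
have DS : F :|: [set a2; c2; b2] \subset S by rewrite subUset FS.
have dDL : [disjoint F :|: [set a2; c2; b2] & L].
  by rewrite disjoint_sym disjointUr disjoint_sym dfL disjoint_sym.
have tD : t \in F :|: [set a2; c2; b2] by rewrite in_setU tG orbT.
have fD : f \in F :|: [set a2; c2; b2] by rewrite in_setU fF.
have ntf : t != f by apply: contraTneq tG => ->; rewrite (disjointFl d2F fF).
have := extended_card LS DS dDL tD fD ntf itf.
by rewrite cL cY ltnn.
Qed.

(** Two seagulls are taken greedily. Without a third, the remaining [2 * s - 1] vertices split into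
    independent sets of sizes [s] and [s - 1]. *)
Lemma pack3 : #|S| = 2 * s + 5 -> 5 <= s -> exists2 P, model nadj S P & #|P| = s + 3.
Proof.
move=> cS s5; pose R := S :\: K.
have dKR : [disjoint K & R] by rewrite disjoints_subset setCD subsetUr.
have cR : #|R| = s + 5.
  by have := cardsID K S; rewrite (setIidPr KS) cK cS /R; clear; lia.
have RS : R \subset S by exact: subsetDl.
have [|G1 gG1 G1R] := find_seagull iK KS RS dKR; first by rewrite cK cR; clear; lia.
have G1S := subset_trans G1R RS.
have c1 := card_seagull e_sym e_irr gG1.
have dKG1 : [disjoint K & G1] by exact: disjointWr G1R dKR.
pose R1 := R :\: G1; have R1R : R1 \subset R by exact: subsetDl.
have dKR1 : [disjoint K & R1] by exact: disjointWr R1R dKR.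
have cR1 : #|R1| = s + 2.
  by have := cardsID G1 R; rewrite (setIidPr G1R) c1 cR /R1; clear; lia.
have [|G2 gG2 G2R] := find_seagull iK KS (subset_trans R1R RS) dKR1.
  by rewrite cK cR1; clear; lia.
have G2S := subset_trans G2R (subset_trans R1R RS).
have c2 := card_seagull e_sym e_irr gG2.
have dKG2 : [disjoint K & G2] by exact: disjointWr G2R dKR1.
have d21 : [disjoint G2 & G1] by move: G2R; rewrite subsetD => /andP[].
pose R2 := R1 :\: G2; have R2R : R2 \subset R1 by exact: subsetDl.
have dKR2 : [disjoint K & R2] by exact: disjointWr R2R dKR1.
case: (boolP [exists G, seagull G && (G \subset R2)]) => [|/existsPn nG].
  case/existsP=> G3 /andP[gG3 G3R].
  apply: (packing_model_size (Gs := [:: G1; G2; G3]) iK cK erefl).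
  rewrite /= gG1 G1S gG2 gG3 !subsetD KS dKG1 dKG2 (disjointWr G3R dKR2) G2S d21.
  move: G3R; rewrite !subsetD => /andP[/andP[/andP[h1 h2] h3] h4].
  by rewrite h1 h3 h4.
have free G : seagull G -> ~~ (G \subset R2).
  by move=> gG; have := nG G; rewrite gG.
have [Y [Z [iY iZ dYZ YZ]]] := seagull_free_bipartition e_sym tri iK dKR2 free.
have YZE : Y :|: Z = S :\: (G1 :|: G2).
  rewrite YZ; apply/setP=> x; rewrite !inE; case: (boolP (x \in K)) => xK.
    by rewrite (disjointFr dKG1 xK) (disjointFr dKG2 xK) (subsetP KS).
  by case: (x \in G1); case: (x \in G2).
have YZS : Y :|: Z \subset S by rewrite YZE subsetDl.
have YS := subset_trans (subsetUl _ _) YZS; have ZS := subset_trans (subsetUr _ _) YZS.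
have : [disjoint Y :|: Z & G1 :|: G2] by rewrite YZE disjoint_sym disjoints_subset setCD subsetUr.
rewrite disjointUr => /andP[dU1 dU2].
have dY1 := disjointWl (subsetUl _ _) dU1; have dZ1 := disjointWl (subsetUr _ _) dU1.
have dY2 := disjointWl (subsetUl _ _) dU2; have dZ2 := disjointWl (subsetUr _ _) dU2.
have cYZ : (#|Y| = s /\ #|Z|.+1 = s) \/ (#|Z| = s /\ #|Y|.+1 = s).
  have := alpha YS iY; have := alpha ZS iZ.
  have e1 := cardsUI Y Z; have e2 := cardsID (G1 :|: G2) S.
  have e3 := cardsUI G1 G2.
  have d1 : #|Y :&: Z| = 0 by apply/eqP; rewrite cards_eq0 setI_eq0.
  have d2 : #|G1 :&: G2| = 0 by apply/eqP; rewrite cards_eq0 setI_eq0 disjoint_sym.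
  have GS : G1 :|: G2 \subset S by rewrite subUset G1S.
  rewrite (setIidPr GS) -YZE in e2.
  by move: cS e1 e2 e3 d1 d2 c1 c2; clear; lia.
case: cYZ => -[cX cL].
  by apply: (pack3_bipartition YS iY cX ZS iZ cL s5 dYZ gG1 gG2) => //; rewrite disjoint_sym.
by apply: (pack3_bipartition ZS iZ cX YS iY cL s5 _ gG1 gG2) => //; rewrite disjoint_sym.
Qed.

End Packing.

(** * Counting in a minimal counterexample *)

Lemma card_bigcup_leq (I T : finType) (P : {pred I}) (F : I -> {set T}) :
  #|\bigcup_(i in P) F i| <= \sum_(i in P) #|F i|.
Proof.
apply: (big_ind2 (fun (X : {set T}) n => #|X| <= n)) => [|X m Y n Xm Yn|//].
  by rewrite cards0.
by rewrite (leq_trans (leq_card_setU _ _)) // leq_add.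
Qed.

Section Bounds.

Variables (T : finType) (e : rel T).
Hypotheses (e_sym : symmetric e) (e_irr : irreflexive e).
Hypothesis tri : forall x y z, e x y -> e y z -> ~~ e x z.
Hypothesis deg5 : forall x, #|[set y | e x y]| <= 5.

Local Notation nadj := (nonadj e).
Local Notation indep := (indep e).

Variable S : {set T}.
Hypothesis oddS : odd #|S|.
Hypothesis sub_model : forall S' : {set T}, S' \proper S ->
  exists2 P, model nadj S' P & #|S'| <= 2 * #|P|.
Hypothesis no_model : forall P : {set {set T}}, model nadj S P -> ~ (#|S| < 2 * #|P|).

Definition nbr x := [set y in S | e x y].

Lemma no_model_even P : model nadj S P -> ~ (#|S| <= 2 * #|P|).
Proof.
move=> mP le; apply: (no_model mP); rewrite ltn_neqAle le andbT.
by apply: contraTneq oddS => ->; rewrite oddM.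
Qed.

(** Otherwise [x] and [y] form a connected dominating pair, and adding it to a model of the rest
    contradicts [no_model_even]. *)
Lemma common_neighbour x y : x \in S -> y \in S -> x != y -> ~~ e x y ->
  exists z, [/\ z \in S, e x z & e y z].
Proof.
move=> xS yS xy nxy; case: (boolP [exists z in S, e x z && e y z]).
  by case/exists_inP=> z zS /andP[xz yz]; exists z.
move/exists_inPn=> no; pose B := [set x; y].
have BS : B \subset S by rewrite subUset !sub1set xS.
have [|P mP le] := sub_model (S' := S :\: B).
  apply/properP; split; first exact: subsetDl.
  by exists x; rewrite // !inE eqxx.
have cB : connected_set nadj B.
  by apply: connected2; [exact: nonadj_sym|rewrite /nonadj xy].
have dom z : z \in S :\: B -> exists2 b, b \in B & nadj b z.
  rewrite !inE negb_or => /andP[/andP[zx zy] zS]; have := no z zS; rewrite negb_and.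
  case/orP=> h; [exists x | exists y]; rewrite ?inE ?eqxx ?orbT //.
    by rewrite /nonadj eq_sym zx.
  by rewrite /nonadj eq_sym zy.
have [mQ cQ] := model_dominating (nonadj_sym e_sym) cB BS dom mP.
case: (no_model_even mQ); rewrite cQ.
have := cardsID B S; rewrite (setIidPr BS) cards2 xy.
by move: le; clear; lia.
Qed.

(* Otherwise {v, w} and {u, u'} are adjacent to each other and to all other
   vertices, and deleting them contradicts the minimality of S. *)
Lemma private_neighbour v u w u' : u \in S -> v \in nbr u -> w \in nbr u -> u' \in nbr v ->
    w != v -> u' != u -> (forall z, z \in S -> e v z -> e w z -> z = u) ->
  exists z, [/\ z \in S, z != v, e u z & e u' z].
Proof.
rewrite !inE => uS /andP[vS uv] /andP[wS uw] /andP[u'S vu'] wv u'u priv.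
case: (boolP [exists z in S, [&& z != v, e u z & e u' z]]).
  by case/exists_inP=> z zS /and3P[zv uz yz]; exists z.
move/exists_inPn=> no.
have vu : e v u by rewrite e_sym.
have nvw : ~~ e v w by apply: tri uw.
have nuu' : ~~ e u u' by apply: tri vu'.
have nvu : v != u by apply: contraTneq uv => ->; rewrite e_irr.
have nwu : w != u by apply: contraTneq uw => ->; rewrite e_irr.
have nu'v : u' != v by apply: contraTneq vu' => ->; rewrite e_irr.
have nu'w : u' != w by apply: contraNneq nvw => <-.
have nwu' : ~~ e w u' by apply: contra u'u => h; rewrite (priv u').
pose B1 := [set v; w]; pose B2 := [set u; u'].
have B1S : B1 \subset S by rewrite subUset !sub1set vS.
have B2S : B2 \subset S :\: B1.
  by rewrite subUset !sub1set !inE !negb_or uS u'S eq_sym nvu eq_sym nwu nu'v nu'w.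
have [|P mP le] := sub_model (S' := (S :\: B1) :\: B2).
  apply/properP; split; first by rewrite (subset_trans (subsetDl _ _)) ?subsetDl.
  by exists u; rewrite // !inE eqxx.
have c1 : connected_set nadj B1.
  by apply: connected2; [exact: nonadj_sym|rewrite /nonadj eq_sym wv].
have c2 : connected_set nadj B2.
  by apply: connected2; [exact: nonadj_sym|rewrite /nonadj eq_sym u'u].
have dom2 z : z \in (S :\: B1) :\: B2 -> exists2 b, b \in B2 & nadj b z.
  rewrite !inE !negb_or => /and3P[/andP[zu zu'] /andP[zv zw] zS].
  have := no z zS; rewrite zv /= negb_and.
  case/orP=> h; [exists u | exists u']; rewrite ?inE ?eqxx ?orbT //.
    by rewrite /nonadj eq_sym zu.
  by rewrite /nonadj eq_sym zu'.
have [mQ cQ] := model_dominating (nonadj_sym e_sym) c2 B2S dom2 mP.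
have dom1 z : z \in (S :\: B2) :\: B1 -> exists2 b, b \in B1 & nadj b z.
  rewrite !inE !negb_or => /and3P[/andP[zv zw] /andP[zu zu'] zS].
  case: (boolP (e v z)) => vz; last first.
    by exists v; rewrite ?inE ?eqxx // /nonadj eq_sym zv.
  exists w; rewrite ?inE ?eqxx ?orbT // /nonadj eq_sym zw /=.
  by apply: contra zu => wz; rewrite (priv z).
have E : (S :\: B1) :\: B2 = (S :\: B2) :\: B1 by rewrite !setDDl setUC.
have t1 C : C \in B2 |: P -> touch nadj B1 C.
  rewrite in_setU1 => /orP[/eqP->|]; last first.
    by rewrite E in mP; exact: dominating_touch dom1 mP _.
  apply/touchP; exists w, u'; rewrite !inE !eqxx !orbT; split=> //.
  by rewrite /nonadj eq_sym nu'w.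
have [mR cR] := model_add (nonadj_sym e_sym) c1 B1S t1 mQ.
case: (no_model_even mR); rewrite cR cQ.
have e1 := cardsID B1 S; have e2 := cardsID B2 (S :\: B1).
rewrite (setIidPr B1S) cards2 eq_sym wv in e1.
rewrite (setIidPr B2S) cards2 eq_sym u'u in e2.
by move: le e1 e2; clear; lia.
Qed.

(** * Paths of length two from a fixed vertex *)

Section Local.

Variable v : T.
Hypothesis vS : v \in S.

Let A := nbr v.
(** By [common_neighbour] this is the second neighbourhood of [v]. *)
Let B := S :\: (v |: A).
(* cod b counts the paths of length two from v to b. *)
Let cod b := #|nbr b :&: A|.
Let priv u := [set b in B | nbr b :&: A == [set u]].
Let ch u := nbr u :\ v.

Let AS u : u \in A -> u \in S. Proof. by rewrite inE => /andP[]. Qed.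
Let Av u : u \in A -> e v u. Proof. by rewrite inE => /andP[]. Qed.
Let BS b : b \in B -> b \in S. Proof. by rewrite !inE => /andP[]. Qed.

Lemma ch_far u b : u \in A -> (b \in ch u) = (b \in B) && e u b.
Proof.
move=> uA; rewrite !inE; case: (eqVneq b v) => //= bv.
case bS: (b \in S); rewrite ?andbF //= ?andbT.
by case ub: (e u b); rewrite ?andbF ?andbT // (tri (Av uA) ub).
Qed.

Lemma cod_gt0 b : b \in B -> 0 < cod b.
Proof.
rewrite !inE negb_or negb_and => /andP[/andP[bv h] bS]; rewrite bS /= in h.
have [|z [zS vz bz]] := common_neighbour vS bS _ h; first by rewrite eq_sym.
by apply/card_gt0P; exists z; rewrite !inE zS vz bz.
Qed.

(** Both sides count the [e]-edges between [A] and [B]. *)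
Lemma sum_cod : \sum_(b in B) cod b = \sum_(u in A) #|ch u|.
Proof.
rewrite (eq_bigr (fun b => \sum_(u in A) (e u b : nat))); last first.
  move=> b bB; rewrite /cod -sum1_card [RHS]big_mkcond [LHS]big_mkcond /=.
  apply: eq_bigr => u _; rewrite inE.
  case uA: (u \in A); rewrite ?andbF // andbT inE (AS uA) /= e_sym.
  by case: (e u b).
rewrite exchange_big /=; apply: eq_bigr => u uA.
rewrite -sum1_card [RHS]big_mkcond [LHS]big_mkcond /=; apply: eq_bigr => b _.
by rewrite ch_far //; case: (b \in B) => //=; case: (e u b).
Qed.

Lemma card_far : #|S| = (#|A| + #|B|).+1.
Proof.
have sub : v |: A \subset S by apply/subsetP=> x; rewrite !inE => /orP[/eqP->|/andP[]].
have := cardsID (v |: A) S; rewrite (setIidPr sub) cardsU1 inE e_irr andbF.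
by rewrite -/B; clear; lia.
Qed.

Lemma privP u b : b \in priv u -> [/\ b \in B, u \in A, e u b & cod b = 1].
Proof.
rewrite inE => /andP[bB /eqP h]; have : u \in nbr b :&: A by rewrite h inE.
by rewrite inE /cod h cards1 inE => /andP[/andP[uS bu] uA]; split=> //; rewrite e_sym.
Qed.

Lemma priv_ch u : priv u \subset ch u.
Proof. by apply/subsetP=> b /privP[bB uA ub _]; rewrite ch_far // bB. Qed.

(** Vertices private to [u] are neighbours of [u] and have no neighbour in [A :\ u], so the two sets
    can be united. *)
Lemma priv_indep u : u \in A ->
  exists X : {set T}, [/\ X \subset S, indep X & #|X| = #|A|.-1 + #|priv u|].
Proof.
move=> uA; exists ((A :\ u) :|: priv u); split.
- apply/subsetP=> x; rewrite in_setU in_setD1 => /orP[/andP[_ /AS]//|/privP[bB _ _ _]].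
  exact: BS.
- have iA : {in A &, forall x y, ~~ e x y}.
    by move=> x y xA yA; apply: (@tri _ v); rewrite ?Av // e_sym Av.
  have ip : {in priv u &, forall x y, ~~ e x y}.
    by move=> x y /privP[_ _ ux _] /privP[_ _ uy _]; apply: (@tri _ u); rewrite // e_sym.
  have iAp x b : x \in A :\ u -> b \in priv u -> ~~ e x b.
    rewrite !in_setD1 => /andP[xu xA]; rewrite inE => /andP[bB /eqP h].
    apply: contra xu => xb; have : x \in nbr b :&: A by rewrite inE xA inE AS // e_sym xb.
    by rewrite h inE.
  apply/indepP=> x y; rewrite !in_setU => /orP[xA|xp] /orP[yA|yp].
  + by move: xA yA; rewrite !in_setD1 => /andP[_ ?] /andP[_ ?]; exact: iA.
  + exact: iAp.
  + by rewrite e_sym iAp.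
  + exact: ip.
- rewrite cardsU (_ : _ :&: _ = set0) ?cards0 ?subn0.
    by have := cardsD1 u A; rewrite uA => ->.
  apply/setP=> x; rewrite in_setI in_setD1 in_set0; apply/negP=> /andP[/andP[_ xA]].
  by case/privP=> + _ _ _; rewrite in_setD in_setU1 xA orbT.
Qed.

(** For each other [u'] in [A], [private_neighbour] with [w := b0] gives a child of [u] joined to
    [u']; a child [b] serves only [(cod b).-1] such vertices. *)
Lemma priv_sum u b0 : b0 \in priv u -> #|A|.-1 <= \sum_(b in ch u) (cod b).-1.
Proof.
move=> b0p; have [b0B uA ub0 _] := privP b0p.
have vu := Av uA.
have cover : A :\ u \subset \bigcup_(b in ch u) ((nbr b :&: A) :\ u).
  apply/subsetP=> u'; rewrite in_setD1 => /andP[u'u u'A].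
  have [|||||||z [zS zv uz u'z]] := @private_neighbour v u b0 u'.
  - exact: AS.
  - by rewrite inE vS e_sym.
  - by rewrite inE BS.
  - by [].
  - by apply: contraTneq b0B => ->; rewrite !inE eqxx.
  - by [].
  - move=> z zS vz bz; move: b0p; rewrite inE => /andP[_ /eqP h].
    by apply/set1P; rewrite -h !inE zS vz bz.
  apply/bigcupP; exists z; first by rewrite in_setD1 zv inE zS.
  by rewrite in_setD1 u'u in_setI u'A inE AS // e_sym u'z.
have le := subset_leq_card cover; rewrite (cardsD1 u A) uA /=.
apply: (leq_trans le); apply: (leq_trans (card_bigcup_leq _ _)).
apply: leq_sum => b; rewrite in_setD1 inE => /andP[_ /andP[bS ub]].
by rewrite /cod (cardsD1 u (nbr b :&: A)) in_setI uA inE AS // e_sym ub.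
Qed.

(** [m2] counts the vertices of [B] reached by several paths, [m3] the paths beyond the second. *)
Let m2 := \sum_(b in B) (1 < cod b : nat).
Let m3 := \sum_(b in B) (cod b - 2).

Lemma cod_split : \sum_(b in B) cod b = #|B| + m2 + m3.
Proof.
rewrite -sum1_card -!big_split /=; apply: eq_bigr => b /cod_gt0.
by case: (cod b) => [|[|n]] //= _; rewrite !subSS subn0 addn1.
Qed.

Lemma card_far_priv : #|B| <= m2 + \sum_(u in A) #|priv u|.
Proof.
have sub : B \subset [set b in B | 1 < cod b] :|: \bigcup_(u in A) priv u.
  apply/subsetP=> b bB; rewrite in_setU inE bB /=.
  have := cod_gt0 bB; rewrite leq_eqVlt => /orP[|->//].
  rewrite eq_sym => /cards1P[u h]; apply/orP; right.
  have /setIP[_ uA] : u \in nbr b :&: A by rewrite h inE.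
  by apply/bigcupP; exists u => //; rewrite inE bB /= h.
apply: leq_trans (subset_leq_card sub) _; apply: leq_trans (leq_card_setU _ _) _.
apply: leq_add (card_bigcup_leq _ _).
rewrite -sum1_card big_mkcond /m2 [X in _ <= X]big_mkcond /=.
by apply: leq_sum => b _; rewrite inE; case: (b \in B) => //=; case: (1 < cod b).
Qed.

Lemma moore : #|S| <= (#|A| + \sum_(u in A) #|ch u|).+1.
Proof.
by have := cod_split; rewrite sum_cod card_far => ->; clear; lia.
Qed.

Lemma priv_sum_far u b0 : b0 \in priv u -> #|A|.-1 <= m2 + m3.
Proof.
move=> b0p; have [_ uA _ _] := privP b0p; apply: leq_trans (priv_sum b0p) _.
rewrite /m2 /m3 -big_split big_mkcond [X in _ <= X]big_mkcond /=.
apply: leq_sum => b _; rewrite ch_far //; case: (b \in B) => //=.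
by case: (e u b) => //=; case: (cod b) => [|[|n]] //=; clear; lia.
Qed.

(** At most 16 paths reach [B], so [#|B| >= 14] forces [m2 + m3 <= 2]. Then a private vertex exists,
    and [priv_sum_far] forces [m2 + m3 >= 3]. *)
Lemma degree4_large : #|A| = 4 -> (forall u, u \in A -> #|ch u| <= 4) -> #|B| < 14.
Proof.
move=> A4 ch4; rewrite ltnNge; apply/negP=> B14.
have s16 : #|B| + m2 + m3 <= 16.
  rewrite -cod_split sum_cod (leq_trans (leq_sum _ ch4)) //.
  by rewrite sum_nat_const A4.
have := card_far_priv; case: (posnP (\sum_(u in A) #|priv u|)) => [->|].
  by move: s16 B14; clear; lia.
rewrite lt0n sum_nat_eq0 negb_forall => /existsP[u]; rewrite negb_imply -lt0n.
case/andP=> _ /card_gt0P[b /priv_sum_far]; rewrite A4.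
by move: s16 B14; clear; lia.
Qed.

(** If [#|priv u| >= c - 1] for some [u], [priv_indep] gives the set. If not, the counts are tight
    and contradict [priv_sum]. *)
Lemma degree4_indep c : 2 < c -> #|A| = 4 -> (forall u, u \in A -> #|ch u| <= c) ->
    4 * c.-1 <= #|B| ->
  exists X : {set T}, [/\ X \subset S, indep X & c + 2 <= #|X|].
Proof.
move=> c3 A4 chc Bc.
case: (boolP [exists u in A, c.-1 <= #|priv u|]) => [/exists_inP[u uA pu]|/exists_inPn small].
  have [X [XS iX cX]] := priv_indep uA; exists X; split=> //.
  by rewrite cX A4; move: pu c3; clear; lia.
have sp : \sum_(u in A) #|priv u| <= 4 * c.-2.
  rewrite -A4 -sum_nat_const; apply: leq_sum => u uA.
  by have := small u uA; rewrite -ltnNge; move: c3; clear; lia.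
have sc : #|B| + m2 + m3 <= 4 * c.
  by rewrite -cod_split sum_cod (leq_trans (leq_sum _ chc)) // sum_nat_const A4.
have := card_far_priv => cfp.
have [eB e2 e3] : [/\ m2 = 4, m3 = 0 & 4 * c.-2 <= \sum_(u in A) #|priv u|].
  by move: c3 Bc sp sc cfp; rewrite /m2 /m3; clear; split; lia.
have [u uA pu] : exists2 u, u \in A & c.-2 <= #|priv u|.
  apply/exists_inP; move: e3; apply: contraTT => /exists_inPn h.
  rewrite -ltnNge; apply: (@leq_ltn_trans (4 * (c - 3))); last by move: c3; clear; lia.
  rewrite -A4 -sum_nat_const; apply: leq_sum => w wA.
  by have := h w wA; rewrite -ltnNge; clear; lia.
have /card_gt0P[b0 b0p] : 0 < #|priv u| by move: pu c3; clear; lia.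
(* At most two children of [u] are not private, each adding at most one to a sum that must reach
   three. *)
have := priv_sum b0p; rewrite A4.
have : \sum_(b in ch u) (cod b).-1 <= #|ch u :\: priv u|.
  rewrite -sum1_card big_mkcond [X in _ <= X]big_mkcond /=; apply: leq_sum => b _.
  rewrite in_setD; case bch: (b \in ch u); rewrite ?andbF //=.
  have bB : b \in B by move: bch; rewrite ch_far // => /andP[].
  have ub : e u b by move: bch; rewrite ch_far // => /andP[].
  have cb : cod b <= 2.
    by move/eqP: e2; rewrite sum_nat_eq0 => /forallP/(_ b); rewrite bB subn_eq0.
  have := cod_gt0 bB; case: (eqVneq (cod b) 1) => [->//|c1 c0].
  rewrite ifT; first by move: cb c1 c0; clear; lia.
  by rewrite andbT; apply: contraNN c1 => /privP[_ _ _ ->].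
have := cardsID (priv u) (ch u); rewrite (setIidPr (priv_ch u)).
by have := chc u uA; move: pu c3; clear; lia.
Qed.

End Local.

(** Swapping ends is a fixed-point-free involution of the [#|S| * d] ordered edges, and [#|S|] is
    odd. *)
Lemma regular_even d : (forall x, x \in S -> #|nbr x| = d) -> ~~ odd d.
Proof.
move=> reg; pose E := [set p : T * T | [&& p.1 \in S, p.2 \in S & e p.1 p.2]].
have cE : #|E| = #|S| * d.
  transitivity (\sum_x \sum_y (if (x, y) \in E then 1 else 0)).
    by rewrite pair_bigA -sum1_card big_mkcond; apply: eq_bigr => -[x y].
  rewrite -sum_nat_const [RHS]big_mkcond; apply: eq_bigr => x _.
  case xS: (x \in S); last by rewrite big1 // => y _; rewrite inE /= xS.
  rewrite -(reg x xS) -sum1_card [RHS]big_mkcond; apply: eq_bigr => y _.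
  by rewrite !inE /= xS.
have := @card_involution _ E (fun p => (p.2, p.1)).
rewrite (_ : [set x in E | _] = set0); last first.
  apply/setP=> -[x y]; rewrite !inE /=; apply/negP=> /andP[/and3P[_ _ xy] /eqP[h _]].
  by rewrite h e_irr in xy.
rewrite cards0 addn0 cE => h.
have := congr1 odd (h _ _); rewrite oddM oddS /= oddM /= => -> //.
- by case.
- by case=> x y; rewrite !inE /= e_sym => /and3P[-> -> ->].
Qed.

Lemma card_children v u : v \in S -> u \in nbr v -> #|nbr u| = #|nbr u :\ v|.+1.
Proof. by move=> vS; rewrite inE => /andP[uS vu]; rewrite (cardsD1 v) inE vS e_sym vu. Qed.

Lemma moore_bound v d : v \in S -> (forall u, u \in S -> #|nbr u| <= d) ->
  #|S| <= (#|nbr v| * d).+1.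
Proof.
move=> vS le; apply: leq_trans (moore vS) _.
rewrite ltnS -sum_nat_const -[X in X + _]sum1_card -big_split /=; apply: leq_sum => u uA.
by rewrite add1n -card_children // le //; move: uA; rewrite inE => /andP[].
Qed.

Lemma nbr_le5 u : #|nbr u| <= 5.
Proof.
apply: leq_trans (deg5 u); apply/subset_leq_card/subsetP=> x.
by rewrite !inE => /andP[].
Qed.

(** * Bounds on the order and the independence number *)

Section Order.

Variable s : nat.
Hypothesis alpha : forall X : {set T}, X \subset S -> indep X -> #|X| <= s.

Lemma nbr_le_alpha u : #|nbr u| <= s.
Proof.
apply: alpha; first by apply/subsetP=> x; rewrite inE => /andP[].
by apply: (indep_neighbours e_sym tri (x := u)) => x; rewrite inE => /andP[].
Qed.

Lemma exists_degree d v0 : v0 \in S -> odd d -> (forall v, v \in S -> d.-1 <= #|nbr v| <= d) ->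
  exists2 v, v \in S & #|nbr v| = d.-1.
Proof.
move=> v0S od deg; case: (boolP [exists v in S, #|nbr v| == d.-1]).
  by case/exists_inP=> v vS /eqP; exists v.
move/exists_inPn=> no; suff: ~~ odd d by rewrite od.
apply: regular_even => x xS.
by have := deg x xS; have := no x xS; clear; lia.
Qed.

Lemma exists_large_degree v0 d : v0 \in S -> d * d < #|S|.-1 ->
  exists2 v, v \in S & d < #|nbr v|.
Proof.
move=> v0S lt; case: (boolP [exists v in S, d < #|nbr v|]) => [/exists_inP//|/exists_inPn h].
have le u : u \in S -> #|nbr u| <= d by move=> uS; rewrite leqNgt h.
have := moore_bound v0S le; have := leq_mul (le v0 v0S) (leqnn d).
by move: lt; clear; lia.
Qed.

Lemma degree4_bound v c : v \in S -> 2 < c -> #|nbr v| = 4 ->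
  (forall u, u \in S -> #|nbr u| <= c.+1) -> 4 * c < #|S| -> c + 2 <= s.
Proof.
move=> vS c3 v4 deg lt.
have ch u : u \in nbr v -> #|nbr u :\ v| <= c.
  by move=> uA; rewrite -ltnS -card_children // deg //; move: uA; rewrite inE => /andP[].
have [|X [XS iX cX]] := @degree4_indep v vS c c3 v4 ch.
  by have := card_far vS; rewrite v4; move: lt; clear; lia.
exact: leq_trans cX (alpha XS iX).
Qed.

(** With 19 or more vertices all degrees are 4 or 5. Not all are 5, by parity, and a vertex of
    degree 4 has at least 14 vertices at distance two, against [degree4_large]. *)
Lemma order_bound : #|S| <= 17.
Proof.
rewrite leqNgt; apply/negP=> lt.
have [v0 v0S] : exists v, v \in S by apply/card_gt0P; move: lt; clear; lia.
have n19 : 19 <= #|S| by move: lt oddS; clear; lia.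
have deg v : v \in S -> 4 <= #|nbr v| <= 5.
  move=> vS; rewrite nbr_le5 andbT.
  by have := moore_bound vS (fun u _ => nbr_le5 u); move: n19; clear; lia.
have [v vS v4] := exists_degree v0S (isT : odd 5) deg.
have ch u : u \in nbr v -> #|nbr u :\ v| <= 4.
  by move=> uA; rewrite -ltnS -card_children // nbr_le5.
have := degree4_large vS v4 ch; have := card_far vS; rewrite v4.
by move: n19; clear; lia.
Qed.

(** Neighbourhoods are independent, so large degrees bound [s] from below. Orders 17 and 13 also
    need [degree4_bound], and order 9 the absence of cubic graphs of odd order. *)
Lemma alpha_bound :
  [/\ #|S| = 17 -> 6 <= s, 13 <= #|S| -> 5 <= s, 9 <= #|S| -> 4 <= s,
      7 <= #|S| -> 3 <= s & 3 <= #|S| -> 2 <= s].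
Proof.
have /card_gt0P[v0 v0S] : 0 < #|S| by move: oddS; case: #|S|.
have big d : d * d < #|S|.-1 -> d < s.
  by move=> /(exists_large_degree v0S)[v _ lt]; exact: leq_trans lt (nbr_le_alpha v).
split=> [n17|n13|n9|n7|n3].
- have deg v : v \in S -> 4 <= #|nbr v| <= 5.
    move=> vS; rewrite nbr_le5 andbT.
    by have := moore_bound vS (fun u _ => nbr_le5 u); rewrite n17; clear; lia.
  have [v vS v4] := exists_degree v0S (isT : odd 5) deg.
  by apply: (degree4_bound vS (c := 4)) => //; [move=> u _; exact: nbr_le5|rewrite n17].
- rewrite ltnNge; apply/negP=> s4.
  have [|v vS v3] := exists_large_degree v0S (d := 3); first by move: n13; clear; lia.
  have v4 : #|nbr v| = 4 by have := nbr_le_alpha v; move: v3 s4; clear; lia.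
  have s5 : 3 + 2 <= s.
    apply: (degree4_bound vS _ v4) => // u _; exact: leq_trans (nbr_le_alpha u) s4.
  by move: s5 s4; clear; lia.
- case: (ltnP 9 #|S|) => [n10|n9']; first by apply: big; move: n10 oddS; clear; lia.
  rewrite ltnNge; apply/negP=> s3.
  have deg v : v \in S -> #|nbr v| = 3.
    move=> vS; have le u : u \in S -> #|nbr u| <= 3.
      by move=> _; exact: leq_trans (nbr_le_alpha u) s3.
    by have := moore_bound vS le; have := le v vS; move: n9; clear; lia.
  by have := regular_even deg.
- by apply: big; move: n7; clear; lia.
- by apply: big; move: n3; clear; lia.
Qed.

End Order.

Lemma no_critical : False.
Proof.
have h0 : (set0 \subset S) && indep set0.
  by rewrite sub0set; apply/indepP=> x y; rewrite inE.
have [K /andP[KS iK] maxK] :=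
  @arg_maxnP _ set0 (fun X => (X \subset S) && indep X) (fun X => #|X|) h0.
have alpha (X : {set T}) : X \subset S -> indep X -> #|X| <= #|K|.
  by move=> XS iX; apply: maxK; rewrite XS.
have le17 := order_bound; have [b17 b13 b9 b7 b3] := alpha_bound alpha.
have model_size q P : model nadj S P -> #|P| = #|K| + q -> ~~ (#|S| < 2 * (#|K| + q)).
  by move=> mP <-; apply/negP; exact: no_model.
have [P mP cP] := packing_model e_sym e_irr tri iK (S := S) (Gs := [::]) KS.
have := model_size _ _ mP cP; rewrite -leqNgt addn0 => le0.
have lt0 : 2 * #|K| < #|S|.
  by move: le0 oddS; rewrite leq_eqVlt => /orP[/eqP<-|//]; rewrite oddM.
have [P1 mP1 cP1] := pack1 e_sym e_irr tri alpha KS iK erefl lt0.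
have := model_size _ _ mP1 cP1; rewrite -leqNgt => le1.
(* Parity and [le1] give [#|S| >= 2 * #|K| + 3]; against the lower bounds on [#|K|] for orders up to
   17 only two cases survive. *)
have : (#|S| = 2 * #|K| + 3 /\ 4 <= #|K|) \/ (#|S| = 2 * #|K| + 5 /\ 5 <= #|K|).
  by move: oddS le17 b17 b13 b9 b7 b3 lt0 le1; clear; lia.
case=> -[cS sK].
  have [P2 mP2 cP2] := pack2 e_sym e_irr tri alpha KS iK erefl cS sK.
  by have := model_size _ _ mP2 cP2; rewrite cS; clear; lia.
have [P3 mP3 cP3] := pack3 e_sym e_irr tri alpha KS iK erefl cS sK.
by have := model_size _ _ mP3 cP3; rewrite cS; clear; lia.
Qed.

End Bounds.

(** * From the graph to its colouring and its minor *)

Lemma matched_model_all (T : finType) (e : rel T) (S : {set T}) :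
    symmetric e -> irreflexive e ->
    (forall x y z, e x y -> e y z -> ~~ e x z) ->
    (forall x, #|[set y | e x y]| <= 5) ->
  matched_model e S.
Proof.
move=> e_sym e_irr tri deg5; apply: matched_model_proper_ind => // {}S IH _ oS.
apply: contrapT => no; apply: (no_critical e_sym e_irr tri deg5 oS).
  by move=> S' /IH[m [P [_ mP le]]]; exists P => //; apply: leq_trans le; exact: leq_addr.
by move=> P mP lt; apply: no; exists P.
Qed.

(** In the complement of the star the centre is isolated and the leaves form a clique; they
    correspond to [v] and [D]. *)
Lemma clique_isolated_induced (G : sgraph) n (v : G) (D : {set G}) :
    #|D| = n -> v \notin D -> {in D, forall x, ~~ adj v x} ->
    {in D &, forall x y, x != y -> adj x y} ->
  contains_induced G (compl_graph (complete_bipartite 1 n)).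
Proof.
move=> cD vD vfar cl; exists (v |: D); subst n.
have vS : v \in v |: D by rewrite setU11.
have DS (i : 'I_#|D|) : enum_val i \in v |: D by rewrite setU1r // enum_valP.
pose g (x : 'I_1 + 'I_#|D|) : induced (v |: D) :=
  match x with inl _ => Sub v vS | inr i => Sub (enum_val i) (DS i) end.
have nv (i : 'I_#|D|) : (v == enum_val i) = false.
  by apply: contraNF vD => /eqP->; exact: enum_valP.
have ginj : injective g.
  move=> [i|i] [j|j] /(congr1 val) /= h.
  - by rewrite (ord1 i) (ord1 j).
  - by move: (nv j); rewrite h eqxx.
  - by move: (nv i); rewrite h eqxx.
  - by rewrite (enum_val_inj h).
have [f fK gK] : bijective g.
  apply: inj_card_bij => //.
  by rewrite card_sum !card_ord card_sig cardsU1 vD.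
exists f; first by exists g.
have adjg x y : @adj (compl_graph (complete_bipartite 1 #|D|)) x y = adj (g x) (g y).
  case: x y => [i|i] [j|j]; rewrite /adj /= /compl_adj /induced_adj /=.
  - by rewrite (ord1 i) (ord1 j) eqxx; exact: esym (adj_irr _).
  - apply/esym/negbTE/vfar/enum_valP.
  - apply/esym/negbTE; rewrite -[X in ~~ X]/(adj _ _) adj_sym; apply/vfar/enum_valP.
  - rewrite /adj /= /bipartite_adj /= andbT; case: (eqVneq i j) => [->|ij].
      by rewrite eqxx; exact: esym (adj_irr _).
    have ij' : enum_val i != enum_val j :> G by apply: contra ij => /eqP/enum_val_inj->.
    by rewrite (inj_eq (@inr_inj _ _)) ij; apply/esym/cl => //; exact: enum_valP.
by move=> x y; rewrite adjg !gK.
Qed.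

Theorem theorem2 (G : sgraph)
  (alpha_le2 : independence_number G <= 2)
  (noK16c : ~ contains_induced G (compl_graph (complete_bipartite 1 6))) :
  hadwiger_number G >= chromatic_number G.
Proof.
pose e : rel G := fun x y => (x != y) && ~~ adj x y.
have e_sym : symmetric e by move=> x y; rewrite /e eq_sym adj_sym.
have e_irr : irreflexive e by move=> x; rewrite /e eqxx.
have tri x y z : e x y -> e y z -> ~~ e x z.
  move=> /andP[xy nxy] /andP[yz nyz]; apply/negP=> /andP[xz nxz].
  have st : stable [set x; y; z].
    apply/forall_inP=> a aS; apply/forall_inP=> b; move: aS; rewrite !inE.
    by move=> /orP[/orP[]|] /eqP-> /orP[/orP[]|] /eqP->; rewrite ?adj_irr // adj_sym.
  have := leq_trans (leq_bigmax_cond (F := fun S : {set G} => #|S|) _ st) alpha_le2.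
  by rewrite -setUA cardsU1 cards2 !inE negb_or xy xz yz.
(* Six [e]-neighbours of [x] are pairwise adjacent, as [e] is triangle-free, and with [x] they
   induce the forbidden graph. *)
have deg5 x : #|[set y | e x y]| <= 5.
  rewrite leqNgt; apply/negP=> /card_geqP[s [us cs sub]]; apply: noK16c.
  pose D := [set y in s].
  have Dx y : y \in D -> e x y by rewrite inE => /sub; rewrite inE.
  apply: (@clique_isolated_induced _ _ x D).
  - by rewrite cardsE (card_uniqP us).
  - by apply/negP=> /Dx; rewrite e_irr.
  - by move=> y /Dx /andP[].
  - move=> y z /Dx xy /Dx xz yz; apply/negPn/negP=> nyz.
    have exz : e y z by rewrite /e yz.
    by have := tri _ _ _ xy exz; rewrite xz.
have [m [P [mm mP le]]] := matched_model_all [set: G] e_sym e_irr tri deg5.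
have nE : nonadj e = @adj G.
  apply/funext=> x; apply/funext=> y; rewrite /nonadj /e negb_and !negbK.
  by case: (eqVneq x y) => // ->; rewrite adj_irr.
rewrite nE in mP; apply: leq_trans (model_hadwiger mP).
(* The number of colours is half the sum of the order and the number of missed vertices, hence at
   most [#|P|]. *)
have := matching_colorable mm; have := matching_parity mm.
rewrite /chromatic_number; case: ex_minnP => k _ mink par /mink /leq_trans; apply.
by move: le par; clear; lia.
Qed.
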